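(* For any permutrees $T,T'$, the product $\mathbb P_T\cdot\mathbb P_{T'}$ in the permutree algebra is given by $$\mathbb P_T\cdot\mathbb P_{T'}=\sum_S\mathbb P_S,$$ where $S$ runs over the interval between $T\backslash T'$ and $T/T'$ in the $\delta(T)\delta(T')$-permutree lattice.
   Context: Permutrees. A decoration of size $n$ is a word $\delta=\delta_1\cdots\delta_n$ in the symbols $\mathsf N$ (none), $\mathsf D$ (down), $\mathsf U$ (up), $\mathsf X$ (both). A permutree is a directed tree $T$ with $n$ vertices labeled bijectively by $[n]=\{1,\dots,n\}$ (vertices are identified with labels) in which each vertex has one or two parents (outgoing neighbors) and one or two children (incoming neighbors); a parent or child may be an unlabeled leaf (dangling edge), so ancestor and descendant subtrees may be empty. The ancestor (resp. descendant) subtree of $i$ through a given parent (resp. child) is the whole connected component, reached through it, of the tree with $i$ removed. If $i$ has two parents (resp. children), they are distinguished as left and right, and all labels in the left ancestor (resp. descendant) subtree of $i$ are smaller than $i$ while all labels in the right one are larger than $i$. The decoration of $T$ is given by $\delta(T)_i=\mathsf N,\mathsf D,\mathsf U,\mathsf X$ according to whether $i$ has (one parent, one child), (one parent, two children), (two parents, one child), (two parents, two children). Permutrees are drawn with edges oriented upwards and vertices from left to right by labels; the dangling outgoing (resp. incoming) edges are thereby ordered from left to right. Grafting. $T\backslash T'$ (resp. $T/T'$) is the permutree obtained by grafting the rightmost outgoing (resp. incoming) dangling edge of $T$ to the leftmost incoming (resp. outgoing) dangling edge of $T'$, while shifting all labels of $T'$ by the number of vertices of $T$. Both have decoration the concatenation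 $\delta(T)\delta(T')$. Permutree lattice. Let $i\to j$ be an edge of a permutree $T$ with decoration $\delta$ and $i<j$. Let $B$ be the only (resp. the right) descendant subtree of $i$ if $\delta_i\in\{\mathsf N,\mathsf U\}$ (resp. $\{\mathsf D,\mathsf X\}$), and $A$ the only (resp. the left) ancestor subtree of $j$ if $\delta_j\in\{\mathsf N,\mathsf D\}$ (resp. $\{\mathsf U,\mathsf X\}$). The increasing rotation of $i\to j$ transforms $T$ into the permutree with decoration $\delta$ obtained by reversing $i\to j$ into $j\to i$, attaching $A$ as ancestor subtree to $i$ (in the place of $j$) and $B$ as descendant subtree to $j$ (in the place of $i$). The $\delta$-permutree lattice is the reflexive transitive closure, on permutrees with decoration $\delta$, of the increasing rotations. Algebra. A decorated permutation is a permutation of some $[n]$ each of whose letters carries a decoration in $\{\mathsf N,\mathsf D,\mathsf U,\mathsf X\}$. On the vector space (over a fixed field) with basis $(\mathbb F_\tau)$ indexed by decorated permutations, the product is $\mathbb F_\tau\cdot\mathbb F_{\tau'}=\sum_\sigma\mathbb F_\sigma$, where $\sigma$ runs over all shuffles of the word $\tau$ with the word $\tau'$ whose values are all shifted by the length of $\tau$, decorations travelling with their values. For a permutree $T$, $\mathbb P_T=\sum_\tau\mathbb F_\tau$ over all linear extensions $\tau$ of $T$ (permutations where $i$ appears before $j$ for each edge $i\to j$ of $T$), with each value $i$ decorated by $\delta(T)_i$. The permutree algebra is the subalgebra spanned by the $\mathbb P_T$. *)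

(* Defs.v *)
From HB Require Import structures.
From mathcomp Require Import all_boot all_algebra all_fingroup.
From mathcomp Require Import finmap.
From mathcomp.multinomials Require Import monalg.

Set Implicit Arguments.
Unset Strict Implicit.
Unset Printing Implicit Defensive.

Import GRing.Theory.
Local Open Scope ring_scope.

(* The labels 1, ..., n are represented by the elements 0, ..., n-1 of 'I_n,  *)
(* and directed edges i -> j (drawn upwards, from i to its parent j) by pairs *)
(* (i, j).                                                                    *)

Inductive decor := DecN | DecD | DecU | DecX.

Definition two_parents (d : decor) : bool :=
  match d with DecU | DecX => true | _ => false end.

Definition two_children (d : decor) : bool :=
  match d with DecD | DecX => true | _ => false end.

Definition decor_code (d : decor) : bool * bool :=
  (two_parents d, two_children d).

Definition decor_decode (c : bool * bool) : decor :=
  match c with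
  | (false, false) => DecN
  | (false, true) => DecD
  | (true, false) => DecU
  | (true, true) => DecX
  end.

Lemma decor_codeK : cancel decor_code decor_decode.
Proof. by case. Qed.

HB.instance Definition _ := Finite.copy decor (can_type decor_codeK).

(* Only the n labelled vertices and the edges between them are recorded: the  *)
(* decoration prescribes the numbers of parents and children of each vertex,  *)
(* and those parents and children that are not labelled are leaves, that is,  *)
(* dangling edges.                                                            *)
Definition decorated_digraph (n : nat) : Type :=
  ({ffun 'I_n -> decor} * {set 'I_n * 'I_n})%type.

HB.instance Definition _ n :=
  Finite.copy (decorated_digraph n)
    ({ffun 'I_n -> decor} * {set 'I_n * 'I_n})%type.

Section Permutrees.
Variable n : nat.
Implicit Types (E : {set 'I_n * 'I_n}) (T S : decorated_digraph n).
Implicit Types i j k : 'I_n.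

Definition decoration T : {ffun 'I_n -> decor} := T.1.
Definition edges T : {set 'I_n * 'I_n} := T.2.

Definition adj E : rel 'I_n := fun i j => ((i, j) \in E) || ((j, i) \in E).

(* A simple cycle has at most n vertices, hence the bound on k. *)
Definition acyclic E : bool :=
  [forall k : 'I_n.+1, forall c : k.-tuple 'I_n,
     (2 < k)%N ==> ~~ ucycleb (adj E) c].

(* The first condition excludes loops and pairs of opposite edges. *)
Definition directed_tree E : bool :=
  [&& [forall i, forall j, ((i, j) \in E) ==> ((j, i) \notin E)],
      [forall i, forall j, connect (adj E) i j]
    & acyclic E].

Definition parents T i : {set 'I_n} := [set j | (i, j) \in edges T].
Definition children T i : {set 'I_n} := [set j | (j, i) \in edges T].

(* For j adjacent to i, the labels of the ancestor or descendant subtree of i *)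
(* through j: the component of j once i is removed.                           *)
Definition subtree_through T i j : {set 'I_n} :=
  [set k | connect
     [rel x y | [&& adj (edges T) x y, x != i & y != i]] j k].

(* Condition on the set A of labelled parents (resp. children) of i, with two *)
(* telling whether i has two parents (resp. children). An element j of A is   *)
(* necessarily on the left if j < i and on the right if i < j, as j belongs   *)
(* to the subtree of i through j.                                             *)
Definition slots_ok T i (two : bool) (A : {set 'I_n}) : bool :=
  if two then
    [&& (#|[set j in A | (j < i)%N]| <= 1)%N,
        (#|[set j in A | (i < j)%N]| <= 1)%N
      & [forall j in A, forall k in subtree_through T i j,
           if (j < i)%N then (k < i)%N else (i < k)%N]]
  else (#|A| <= 1)%N.

Definition permutree T : bool :=
  directed_tree (edges T) &&
  [forall i, slots_ok T i (two_parents (decoration T i)) (parents T i)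
          && slots_ok T i (two_children (decoration T i)) (children T i)].

(* An outgoing (resp. incoming) dangling edge at i is an unlabelled parent    *)
(* (resp. child) of i.                                                        *)
Definition out_dangling T i : bool :=
  (#|parents T i| < if two_parents (decoration T i) then 2 else 1)%N.

Definition in_dangling T i : bool :=
  (#|children T i| < if two_children (decoration T i) then 2 else 1)%N.

(* Vertices are placed from left to right by labels, so the rightmost (resp.  *)
(* leftmost) of the dangling edges of a given kind is carried by the vertex   *)
(* with largest (resp. smallest) label that has one.                          *)
Definition rightmost (P : pred 'I_n) i : bool :=
  P i && [forall j, P j ==> (j <= i)%N].

Definition leftmost (P : pred 'I_n) i : bool :=
  P i && [forall j, P j ==> (i <= j)%N].

(* For an edge i -> j with i < j: the root of the subtree B (resp. A) moved   *)
(* by the rotation, as a set with at most one element, which is empty when    *)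
(* the subtree is a leaf.                                                     *)
Definition rot_B T i : {set 'I_n} :=
  [set b in children T i | two_children (decoration T i) ==> (i < b)%N].

Definition rot_A T j : {set 'I_n} :=
  [set a in parents T j | two_parents (decoration T j) ==> (a < j)%N].

Definition rotate T i j : decorated_digraph n :=
  (decoration T,
   (edges T :\: ([set (i, j)] :|: [set (b, i) | b in rot_B T i]
                              :|: [set (j, a) | a in rot_A T j]))
   :|: ([set (j, i)] :|: [set (b, j) | b in rot_B T i]
                     :|: [set (i, a) | a in rot_A T j])).

Definition increasing_rotation : rel (decorated_digraph n) := fun T S =>
  [&& permutree T, permutree S &
      [exists i, exists j,
         [&& (i, j) \in edges T, (i < j)%N & S == rotate T i j]]].

(* Rotations preserve decorations, so this is the disjoint union over delta   *)
(* of the orders of the delta-permutree lattices.                             *)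
Definition permutree_le : rel (decorated_digraph n) :=
  connect increasing_rotation.

Definition permutree_interval (L R : decorated_digraph n) :
    {set decorated_digraph n} :=
  [set S | [&& permutree S, permutree_le L S & permutree_le S R]].

End Permutrees.

Section Grafting.
Variables n m : nat.
Variables (T : decorated_digraph n) (T' : decorated_digraph m).

Definition cat_decoration : {ffun 'I_(n + m) -> decor} :=
  [ffun i => match split i with
             | inl j => decoration T j
             | inr k => decoration T' k
             end].

Definition union_edges : {set 'I_(n + m) * 'I_(n + m)} :=
  [set (lshift m e.1, lshift m e.2) | e in edges T]
  :|: [set (rshift n e.1, rshift n e.2) | e in edges T'].

(* T \ T'. When T or T' has no vertex, there is no edge to add. *)
Definition graft_backslash : decorated_digraph (n + m) :=
  (cat_decoration,
   union_edges :|: [set (lshift m e.1, rshift n e.2) | e : 'I_n * 'I_m &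
                     rightmost (out_dangling T) e.1
                     && leftmost (in_dangling T') e.2]).

(* T / T' *)
Definition graft_slash : decorated_digraph (n + m) :=
  (cat_decoration,
   union_edges :|: [set (rshift n e.2, lshift m e.1) | e : 'I_n * 'I_m &
                     rightmost (in_dangling T) e.1
                     && leftmost (out_dangling T') e.2]).

End Grafting.

Fixpoint shuffles (A : Type) (u : seq A) {struct u} : seq A -> seq (seq A) :=
  fix shuffles_u (v : seq A) : seq (seq A) :=
    match u, v with
    | [::], _ => [:: v]
    | _, [::] => [:: u]
    | a :: u', b :: v' =>
        [seq a :: w | w <- shuffles u' v] ++ [seq b :: w | w <- shuffles_u v']
    end.

Definition decorated_word : Type := seq (nat * decor).

Definition is_decorated_perm (w : decorated_word) : bool :=
  perm_eq [seq x.1 | x <- w] (iota 0 (size w)).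

Record decorated_perm := DecoratedPerm {
  dp_word :> decorated_word;
  dp_wordP : is_decorated_perm dp_word }.

HB.instance Definition _ := [isSub for dp_word].
HB.instance Definition _ := [Choice of decorated_perm by <:].

Definition shift_word (k : nat) (w : decorated_word) : decorated_word :=
  [seq ((k + x.1)%N, x.2) | x <- w].

Definition shifted_shuffles (s t : decorated_perm) : seq decorated_word :=
  shuffles (dp_word s) (shift_word (size (dp_word s)) (dp_word t)).

Lemma shuffles_perm_eq (A : eqType) (u v w : seq A) :
  w \in shuffles u v -> perm_eq w (u ++ v).
Proof.
elim: u v w => [|a u IHu]; first by case=> [|b v] w; rewrite inE => /eqP ->.
elim=> [|b v IHv] w /=; first by rewrite cats0 inE => /eqP ->.
rewrite mem_cat => /orP[] /mapP[x xin ->]; first by rewrite perm_cons IHu.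
have /= pw := IHv _ xin.
apply: (@perm_trans _ (b :: a :: u ++ v)); first by rewrite perm_cons.
by rewrite -!cat_cons perm_sym perm_catC /= perm_cons perm_catC.
Qed.

Lemma shifted_shuffles_perm (s t : decorated_perm) (w : decorated_word) :
  w \in shifted_shuffles s t -> is_decorated_perm w.
Proof.
move=> /shuffles_perm_eq pw; rewrite /is_decorated_perm (perm_size pw).
apply: (perm_trans (perm_map _ pw)).
rewrite map_cat size_cat size_map iotaD; apply: perm_cat; first exact: dp_wordP.
rewrite -map_comp add0n -[X in iota X]addn0 iotaDl.
rewrite (_ : map _ (dp_word t) =
  map (addn (size (dp_word s))) [seq x.1 | x <- dp_word t]).
  by apply: perm_map; apply: dp_wordP.
by rewrite -map_comp.
Qed.

(* By this fact, [pmap insub] loses no shuffle in the product below. *)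
Lemma val_shifted_shuffles (s t : decorated_perm) :
  [seq dp_word w | w <- pmap insub (shifted_shuffles s t)]
  = shifted_shuffles s t.
Proof.
rewrite (pmap_filter (insubK _)); apply/all_filterP/allP => w win.
by rewrite isSome_insub; apply: shifted_shuffles_perm win.
Qed.

Section Algebra.
Variable K : fieldType.

(* The basis vector F_s is << s >>. *)
Notation dp_space := {malg K[decorated_perm]}.

Definition dp_mul_basis (s t : decorated_perm) : dp_space :=
  \sum_(w <- pmap insub (shifted_shuffles s t)) << (w : decorated_perm) >>.

(* Bilinear extension of the product of basis vectors. *)
Definition dp_mul (x y : dp_space) : dp_space :=
  \sum_(s <- msupp x) \sum_(t <- msupp y)
    (mcoeff s x * mcoeff t y) *: dp_mul_basis s t.

Lemma dp_mulUU (s t : decorated_perm) :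
  dp_mul << s >> << t >> = dp_mul_basis s t.
Proof.
by rewrite /dp_mul !msuppU oner_eq0 !big_seq_fset1 !mcoeffUU mulr1 scale1r.
Qed.

Section PermutreeElement.
Variables (n : nat) (T : decorated_digraph n).

(* The permutation s stands for the word s_0 s_1 ... s_(n-1), in which the    *)
(* value i appears at position s^-1 i.                                        *)
Definition linear_extension (s : 'S_n) : bool :=
  [forall i, forall j, ((i, j) \in edges T) ==> ((s^-1)%g i < (s^-1)%g j)%N].

Definition perm_decorated_word (s : 'S_n) : decorated_word :=
  [seq (val (s p), decoration T (s p)) | p <- enum 'I_n].

Lemma perm_decorated_wordP (s : 'S_n) :
  is_decorated_perm (perm_decorated_word s).
Proof.
rewrite /is_decorated_perm size_map size_enum_ord -map_comp.
rewrite -val_enum_ord (map_comp val s); apply/perm_map/uniq_perm.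
- by rewrite map_inj_uniq ?enum_uniq //; apply: perm_inj.
- exact: enum_uniq.
move=> i; rewrite mem_enum; apply/mapP; exists ((s^-1)%g i).
  by rewrite mem_enum.
by rewrite permKV.
Qed.

Definition perm_decorated (s : 'S_n) : decorated_perm :=
  DecoratedPerm (perm_decorated_wordP s).

Definition PT : dp_space :=
  \sum_(s : 'S_n | linear_extension s) << perm_decorated s >>.

End PermutreeElement.
End Algebra.

(* Main.v *)
Require Import Defs.
From mathcomp Require Import all_boot all_order all_algebra all_fingroup.
From mathcomp Require Import finmap zify.
From mathcomp.multinomials Require Import monalg.

Set Implicit Arguments.
Unset Strict Implicit.
Unset Printing Implicit Defensive.
Import Order.TTheory GRing.Theory Num.Theory.

(** Expanding both sides on the basis, the product of P_T and P_T' is the sum of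
    F_s over the permutations s whose small values (those of T) spell a linear
    extension of T and whose large values (those of T', shifted) spell one of T'
    ([dp_mul_sum], [shuffle_basis]). So the theorem says that the sets of linear
    extensions of the permutrees in the interval are disjoint and have this set
    of permutations as union.

    Disjointness. A permutree is determined by its decoration and by any one of
    its linear extensions ([permutree_unique]). A path of the tree that starts
    upwards and is not directed turns at a peak, a vertex with two children,
    which separates the labels of the two ends ([turn_up]). On the other hand,
    for an edge i -> j, every vertex with two children whose label is strictly
    between those of i and j lies below i, and every such vertex with two
    parents lies above j ([wall_down], [wall_up]). If s is a linear extension of
    two permutrees, a turn of the path of the second one that joins the ends of
    an edge of the first one would therefore be at the wrong place in s. Hence
    edges of one tree are directed paths of the other, the two trees define the
    same order, and the edges are the covers of this order.

    Containment. An increasing rotation creates no ancestor relation from a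
    label to a larger one, and destroys none from a label to a smaller one
    ([reversal_mono]). The edges of T and T' belong to both grafts, so their
    ends remain comparable in the same direction all along the interval
    ([interval_restricts]).

    Exhaustion. When a < c are consecutive in a linear extension of S, the word
    with a and c exchanged is a linear extension of S, or, if a -> c is an edge,
    of the rotation of S at this edge ([extension_swap]). The concatenation of
    the small letters and of the large ones is a linear extension of T \ T';
    exchanging consecutive small and large letters leads from it to s, and then
    to the word with all the large letters first, a linear extension of T / T'.
    So the permutree of s exists and lies in the interval ([interval_exists]).

    That rotations and grafts are permutrees ([rotation_ptree], [graft_ptree])
    is proved for a description of permutrees by cuts ([ptree]): every edge is
    the only one that crosses some set of vertices, and the conditions on
    subtrees become conditions on this set. A cut of the new tree is easy to
    write down from the cuts of the old one, whereas its paths are not. *)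

(** * Permutrees described by cuts *)

Section AbstractPermutrees.
Variable V : finType.
Implicit Types (lab : V -> int) (up dn : pred V) (E : rel V) (x y z : V).

Definition adjacent E : rel V := fun x y => E x y || E y x.
Definition opposite E : rel V := fun x y => E y x.

(** [C] is the side of [y] when the edge [x -> y] is removed. *)
Definition edge_cut lab up dn E x y (C : pred V) : Prop :=
  [/\ C y, ~~ C x,
      forall a b, E a b -> (a, b) != (x, y) -> C a = C b,
      up x -> forall z, C z -> (lab x < lab z)%R = (lab x < lab y)%R
    & dn y -> forall z, ~~ C z -> (lab y < lab z)%R = (lab y < lab x)%R].

(** Labels are integers rather than ordinals so that the reflection of the
    picture is [lab |-> - lab]. Together with the reversal of the edges, which
    swaps parents and children, this turns each statement about parents into
    one about children. In [pt_parents] the hypothesis only bites when [x] has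
    two parents: it then says that [y] and [z] are on the same side of [x]. *)
Record ptree lab up dn E : Prop := PTree {
  pt_inj : injective lab;
  pt_conn : forall x y, connect (adjacent E) x y;
  pt_cut : forall x y, E x y -> exists C, edge_cut lab up dn E x y C;
  pt_parents : forall x y z, E x y -> E x z ->
    (up x -> (lab x < lab y)%R = (lab x < lab z)%R) -> y = z;
  pt_children : forall x y z, E y x -> E z x ->
    (dn x -> (lab x < lab y)%R = (lab x < lab z)%R) -> y = z }.

Lemma edge_cut_flip lab up dn E x y C :
  edge_cut lab up dn E x y C ->
  edge_cut lab dn up (opposite E) y x (predC C).
Proof.
case=> Cy Cx nC Ux Dy; split=> //=; first by rewrite negbK.
- by move=> a b Eba ne; rewrite (nC b a) //; apply: contra ne => /eqP[-> ->].
by move=> ux z; rewrite negbK; apply: Ux.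
Qed.

Lemma ptree_flip lab up dn E :
  ptree lab up dn E -> ptree lab dn up (opposite E).
Proof.
case=> I c C p ch; split=> //.
- move=> x y; rewrite -(eq_connect (e := adjacent E)) // => a b.
  by rewrite /adjacent orbC.
by move=> x y /C[D hD]; exists (predC D); apply: edge_cut_flip.
Qed.

Lemma eq_edge_cut lab up dn E E' x y C : E =2 E' ->
  edge_cut lab up dn E x y C -> edge_cut lab up dn E' x y C.
Proof. by move=> e [Cy Cx nC Ux Dy]; split=> // a b; rewrite -e; apply: nC. Qed.

(** All the labels compared in a cut are those of distinct vertices, so that
    reflection negates both sides of each equation. *)
Lemma edge_cut_mirror lab up dn E x y C : injective lab ->
  edge_cut lab up dn E x y C <-> edge_cut (fun x => - lab x)%R up dn E x y C.
Proof.
move=> inj.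
have flipE a b c : a != b -> a != c ->
    ((- lab a < - lab b)%R = (- lab a < - lab c)%R) <->
    ((lab a < lab b)%R = (lab a < lab c)%R).
  move=> ab ac; have : lab a <> lab b by move/inj/eqP; rewrite (negPf ab).
  by have : lab a <> lab c; [move/inj/eqP; rewrite (negPf ac) | lia].
have neqC a b : ~~ C a -> C b -> a != b by move=> Ca Cb; apply: contraNneq Ca => ->.
split=> -[Cy Cx nC Ux Dy]; split=> // h z Cz.
- by apply/flipE; [exact: neqC | exact: neqC | apply: Ux].
- by apply/flipE; [rewrite eq_sym neqC | rewrite eq_sym neqC | apply: Dy].
- by apply/flipE; [exact: neqC | exact: neqC | apply: Ux].
by apply/flipE; [rewrite eq_sym neqC | rewrite eq_sym neqC | apply: Dy].
Qed.

Lemma ptree_mirror lab up dn E :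
  ptree lab up dn E -> ptree (fun x => - lab x)%R up dn E.
Proof.
case=> I c C p ch.
have neq x y : E x y -> x != y.
  by move=> xy; apply: contraTneq xy => <-; apply/negP => /C[D [Dx]]; rewrite Dx.
have flipE x y z : x != y -> x != z ->
    ((- lab x < - lab y)%R = (- lab x < - lab z)%R) ->
    ((lab x < lab y)%R = (lab x < lab z)%R).
  move=> xy xz; have : lab x <> lab y by move/I/eqP; rewrite (negPf xy).
  by have : lab x <> lab z; [move/I/eqP; rewrite (negPf xz) | lia].
split=> //.
- by move=> x y /oppr_inj /I.
- by move=> x y /C[D hD]; exists D; apply/(edge_cut_mirror _ _ _ _ _ _ I).
- move=> x y z xy xz h; apply: (p x) => // /h /flipE; apply; exact: neq.
by move=> x y z xy xz h; apply: (ch x) => // /h /flipE; apply; rewrite eq_sym neq.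
Qed.

Lemma connect_opposite E x y : connect (opposite E) x y = connect E y x.
Proof.
by rewrite (eq_connect (e' := [rel a b | E b a])) // connect_rev.
Qed.

Lemma connect_ind E (W : V -> Prop) x y : connect E x y -> W x ->
  (forall a b, connect E x a -> E a b -> W a -> W b) -> W y.
Proof.
move=> /connectP[p]; elim/last_ind: p y => [|p z IH] y /=; first by move=> _ ->.
rewrite rcons_path last_rcons => /andP[pp e] -> Wx H.
have c : connect E x (last x p) by apply/connectP; exists p.
by apply: (H _ _ c e); apply: (IH (last x p)).
Qed.

Lemma connect_first E x y : connect E x y -> x != y ->
  exists2 z, E x z & connect E z y.
Proof.
move=> /connectP[[|z p]] /=; first by move=> _ ->; rewrite eqxx.
by move=> /andP[xz pp] -> _; exists z => //; apply/connectP; exists p.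
Qed.

Lemma connect_last E x y : connect E x y -> x != y ->
  exists2 z, E z y & connect E x z.
Proof.
rewrite -connect_opposite eq_sym => /connect_first H /H[z zy c]; exists z => //.
by rewrite -connect_opposite.
Qed.

Section Order.
Variables (lab : V -> int) (up dn : pred V) (E : rel V).
Hypothesis P : ptree lab up dn E.

Lemma ptree_irr x : ~~ E x x.
Proof. by apply/negP => /(pt_cut P)[D [Dx]]; rewrite Dx. Qed.

Lemma ptree_neq x y : E x y -> x != y.
Proof. by move=> xy; apply: contraTneq xy => <-; exact: ptree_irr. Qed.

Lemma lab_neq x y : x != y -> lab x <> lab y.
Proof. by move=> xy /(pt_inj P)/eqP; rewrite (negPf xy). Qed.

Lemma uncrossed_const (W : pred V) :
  (forall a b, E a b -> W a = W b) -> forall x y, W x = W y.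
Proof.
move=> h x y; apply: (connect_ind (W := fun y => W x = W y) (pt_conn P x y)) => //.
move=> a b _ ab ->.
by case/orP: ab => /h.
Qed.

Lemma parents_opposite x y z : E x y -> E x z -> y != z ->
  up x /\ (lab x < lab y)%R != (lab x < lab z)%R.
Proof.
move=> xy xz; move/eqP=> yz; apply/andP/negPn/negP => h; apply: yz.
by apply: (pt_parents P xy xz) => ux; apply/eqP; move: h; rewrite ux negbK.
Qed.

Lemma children_opposite x y z : E y x -> E z x -> y != z ->
  dn x /\ (lab x < lab y)%R != (lab x < lab z)%R.
Proof.
move=> yx zx; move/eqP=> yz; apply/andP/negPn/negP => h; apply: yz.
by apply: (pt_children P yx zx) => dx; apply/eqP; move: h; rewrite dx negbK.
Qed.

(** The only edge that crosses the cut enters it. *)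
Lemma cut_up x y C a b : edge_cut lab up dn E x y C ->
  connect E a b -> C a -> C b.
Proof.
move=> [Cy _ nC _ _] ab Ca; apply: (connect_ind (W := C) ab) => // u v _ uv Cu.
have [[_ ->] //|ne] := eqVneq (u, v) (x, y).
by rewrite -(nC _ _ uv ne).
Qed.

Lemma cut_down x y C a b : edge_cut lab up dn E x y C ->
  connect E a b -> ~~ C b -> ~~ C a.
Proof. by move=> /cut_up h /h /contra. Qed.

Lemma edge_nconnect x y : E x y -> ~~ connect E y x.
Proof.
move=> /(pt_cut P)[C Cxy]; apply/negP => /(cut_up Cxy).
by case: Cxy => -> /negP h _ _ _ /(_ isT).
Qed.

Lemma connect_anti x y : connect E x y -> connect E y x -> x = y.
Proof.
move=> xy yx; apply/eqP/negPn/negP => ne.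
have [z xz zy] := connect_first xy ne.
by have := edge_nconnect xz; rewrite (connect_trans zy yx).
Qed.

Lemma cut_cross x y C a b : edge_cut lab up dn E x y C ->
  connect E a b -> ~~ C a -> C b -> connect E a x && connect E y b.
Proof.
move=> h ab Ca; pose W z := C z -> connect E a x && connect E y z.
apply: (connect_ind (W := W) ab) => [|u v au uv IH Cv].
  by move=> Ca'; rewrite Ca' in Ca.
have [[ux vy]|ne] := eqVneq (u, v) (x, y).
  by rewrite -ux -vy au connect0.
have /IH/andP[-> yu] : C u by case: h => _ _ nC _ _; rewrite (nC _ _ uv ne).
exact: connect_trans yu (connect1 uv).
Qed.

(** The tree is oriented without cycles, so ancestor sets shrink strictly
    along edges. *)
Lemma upset_ind (Q : V -> Prop) :
  (forall y, (forall z, connect E y z -> z != y -> Q z) -> Q y) -> forall y, Q y.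
Proof.
move=> h y; have [k] := ubnP #|connect E y|.
elim: k y => // k IH y; rewrite ltnS => le; apply: h => z yz zy; apply: IH.
apply: leq_trans le; apply: proper_card; apply/properP; split.
  by apply/subsetP => w; rewrite !inE; apply: connect_trans.
exists y; rewrite !inE ?connect0 //; apply/negP => zy'.
by move/eqP: zy; apply; apply: connect_anti.
Qed.

Lemma sink_above y : exists2 s, connect E y s & forall z, ~~ E s z.
Proof.
elim/upset_ind: y => y IH.
have [/existsP[z yz]|/existsPn h] := boolP [exists z, E y z].
  have zy : z != y by rewrite eq_sym (ptree_neq yz).
  have [s zs hs] := IH z (connect1 yz) zy.
  by exists s => //; apply: connect_trans zs; apply: connect1.
by exists y.
Qed.

End Order.

(** The component of [y], a neighbor of [x], once [x] is removed. *)
Definition branch E x y : pred V :=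
  connect [rel u v | [&& adjacent E u v, u != x & v != x]] y.

Definition between lab x k y : bool :=
  ((lab x < lab k) && (lab k < lab y) || (lab y < lab k) && (lab k < lab x))%R.

Lemma between_neq lab x k y : between lab x k y -> (k != x) && (k != y).
Proof.
rewrite /between => h; apply/andP; split; apply/eqP => e; subst; lia.
Qed.

Lemma branch_flip E x y : branch (opposite E) x y =1 branch E x y.
Proof. by apply: eq_connect => a b /=; rewrite {1}/adjacent orbC. Qed.

Lemma branch_root E x y : x != y -> ~~ branch E x y x.
Proof.
move=> xy; apply/negP => b; suff /eqP : x != x by [].
apply: (connect_ind (W := fun w => w != x) b); first by rewrite eq_sym.
by move=> u v _ /= /and3P[].
Qed.

Section Branches.
Variables (lab : V -> int) (up dn : pred V) (E : rel V).
Hypothesis P : ptree lab up dn E.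

Lemma branch_exists x z : x != z -> exists2 y, adjacent E x y & branch E x y z.
Proof.
move=> ne; have /connectP[p pp ez] := pt_conn P x z.
case/shortenP: pp ez => -[|y q] /=; first by move=> _ _ _ e; rewrite e eqxx in ne.
case/andP=> xy pq /andP[xq _] _ ->; exists y => //.
apply/connectP; exists q => //; move: xq; rewrite inE negb_or => /andP[].
elim: q y pq {xy} => //= a q IH y /andP[ya pq] xy; rewrite inE negb_or => /andP[xa xq].
by rewrite ya eq_sym xy eq_sym xa IH.
Qed.

Lemma branch_cut x y C z : edge_cut lab up dn E x y C -> branch E x y z -> C z.
Proof.
move=> [Cy Cx nC _ _]; rewrite /branch => b.
apply: (connect_ind (W := C) b) => // u v _ /= /and3P[uv ux vx] Cu.
case/orP: uv => h; rewrite (nC _ _ h) // in Cu *;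
  by apply/eqP => -[e1 e2]; rewrite ?e1 ?e2 eqxx in ux vx.
Qed.

Lemma branch_cutN x y C z : edge_cut lab up dn E y x C -> branch E x y z -> ~~ C z.
Proof.
move=> [Cx Cy nC _ _]; rewrite /branch => b.
apply: (connect_ind (W := fun w => ~~ C w) b) => // u v _ /= /and3P[uv ux vx] Cu.
case/orP: uv => h; rewrite (nC _ _ h) // in Cu *;
  by apply/eqP => -[e1 e2]; rewrite ?e1 ?e2 eqxx in ux vx.
Qed.

Lemma parent_side x y z : E x y -> up x -> branch E x y z ->
  (lab x < lab z)%R = (lab x < lab y)%R.
Proof.
move=> xy ux b; have [C h] := pt_cut P xy.
by have := branch_cut h b; case: h => _ _ _ /(_ ux) H _ /H.
Qed.

Lemma child_side x y z : E y x -> dn x -> branch E x y z ->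
  (lab x < lab z)%R = (lab x < lab y)%R.
Proof.
move=> yx dx b; have [C h] := pt_cut P yx.
by have := branch_cutN h b; case: h => _ _ _ _ /(_ dx) H /H.
Qed.

(** A vertex with two children sees all its descendants through one child on
    the same side. *)
Lemma below_side k x y : dn k -> connect E x y -> connect E y k -> y != k ->
  (lab k < lab x)%R = (lab k < lab y)%R.
Proof.
move=> dk xy yk ne; have [c ck yc] := connect_last yk ne.
have [C h] := pt_cut P ck; have [_ nCc _ _ /(_ dk) H] := h.
have nCy := cut_down h yc nCc.
by rewrite !H // (cut_down h xy).
Qed.

(** Follow the path from [x] to [z]. If it keeps going up, [z] is an ancestor.
    Otherwise let [k] be its first peak: the path arrives at [k] from one child
    and leaves through another one, so [k] has two children and separates the
    two ends. *)
Lemma turn_up x y z : E x y -> branch E x y z ->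
  connect E y z \/
  exists k, [/\ dn k, connect E y k & between lab x k z].
Proof.
elim/(upset_ind P): y x => y IH x xy b.
have [-> | yz] := eqVneq y z; first by left.
have [w yw bw] := branch_exists yz.
have wx : w != x.
  apply: contraTneq bw => ->; apply/negP => bw; have [C h] := pt_cut P xy.
  by have := branch_cut h b; rewrite (negPf (branch_cutN h bw)).
case/orP: yw => yw.
  have wy : w != y by rewrite eq_sym (ptree_neq P yw).
  have [wz|[k [dk wk bk]]] := IH w (connect1 yw) wy y yw bw.
    by left; apply: connect_trans (connect1 yw) wz.
  (* the peak k of the rest of the path has x on the same side as y *)
  right; have yk := connect_trans (connect1 yw) wk.
  have /andP[ky kz] := between_neq bk.
  exists k; split=> //; move: bk; rewrite /between.
  have := below_side dk (connect1 xy) yk; rewrite eq_sym => /(_ ky).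
  have kx : k != x.
    by apply/eqP => e; move: yk; rewrite e (negPf (edge_nconnect P xy)).
  have := lab_neq P ky; have := lab_neq P kx; clear; lia.
right; have [dy ny] := children_opposite P yw xy wx.
exists y; split=> //; rewrite /between.
have := child_side yw dy bw.
have := lab_neq P yz; have := lab_neq P (ptree_neq P xy); move: ny; clear; lia.
Qed.

(** Both ends of the edge are in one branch of [k], on different sides of it, so
    this branch is above [k]. The path from [k] to [i] thus starts upwards, and
    its first peak, if any, is again between [i] and [j]: conclude by induction
    up the tree. *)
Lemma wall_down i j k : E i j -> between lab i k j -> dn k -> connect E k i.
Proof.
move=> ij; elim/(upset_ind P): k => k IH bk dk.
have /andP[ki kj] := between_neq bk.
have [y ky b] := branch_exists ki.
case/orP: ky => ky; last first.
  have bj : branch E k y j.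
    by apply: connect_trans b (connect1 _); rewrite /= /adjacent ij !(eq_sym _ k) ki kj.
  have := child_side ky dk b; have := child_side ky dk bj.
  move: bk; rewrite /between; clear; lia.
have [yi|[k' [dk' yk' bk']]] := turn_up ky b.
  exact: connect_trans (connect1 ky) yi.
have kk' := connect_trans (connect1 ky) yk'.
have /andP[k'k _] := between_neq bk'.
apply: connect_trans (kk') (IH _ kk' k'k _ dk').
by move: bk bk'; rewrite /between; clear; lia.
Qed.

End Branches.

Lemma between_sym lab x k y : between lab x k y = between lab y k x.
Proof. by rewrite /between orbC. Qed.

Lemma wall_up lab up dn E (P : ptree lab up dn E) i j k :
  E i j -> between lab i k j -> up k -> connect E j k.
Proof.
move=> ij b uk; rewrite -connect_opposite.
by apply: (wall_down (ptree_flip P) (j := i)) => //; rewrite between_sym.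
Qed.

Lemma turn_down lab up dn E (P : ptree lab up dn E) x y z :
  E y x -> branch E x y z ->
  connect E z y \/
  exists k, [/\ up k, connect E k y & between lab x k z].
Proof.
rewrite -branch_flip => yx b; have := turn_up (ptree_flip P) yx b.
rewrite connect_opposite => -[|[k []]]; first by left.
by rewrite connect_opposite => *; right; exists k.
Qed.

(** Only the positions of the values in a word matter here: [pos] is any
    function increasing along the edges. *)
Definition extends E (pos : V -> nat) : Prop := forall x y, E x y -> pos x < pos y.

Lemma extends_connect E pos x y :
  extends E pos -> connect E x y -> pos x <= pos y.
Proof.
move=> h xy; apply: (connect_ind (W := fun z => pos x <= pos z) xy) => // a b _ /h.
by move=> ab /leq_trans; apply; apply: ltnW.
Qed.

(** The path of [E'] from [i] to [j] has its first turn between [i] and [j], on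
    one side of [i] in [pos]; the walls of the edge [i -> j] of [E] put this
    vertex on the other side. *)
Lemma common_extension_edge lab up dn E E' pos :
  ptree lab up dn E -> ptree lab up dn E' -> extends E pos -> extends E' pos ->
  subrel E (connect E').
Proof.
move=> P P' e e' i j ij; have pij := e _ _ ij.
have [y iy b] := branch_exists P' (ptree_neq P ij).
case/orP: iy => iy.
  have [yj|[k [dk yk bk]]] := turn_up P' iy b.
    exact: connect_trans (connect1 iy) yj.
  have := extends_connect e (wall_down P ij bk dk).
  by have := extends_connect e' yk; have := e' _ _ iy; move: pij; clear; lia.
have [jy|[k [uk ky bk]]] := turn_down P' iy b.
  by have := extends_connect e' jy; have := e' _ _ iy; move: pij; clear; lia.
have := extends_connect e (wall_up P ij bk uk).
by have := extends_connect e' ky; have := e' _ _ iy; move: pij; clear; lia.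
Qed.

(** An edge is a cover of the ancestor order: a detour would cross its cut. *)
Lemma cover_edge lab up dn E (P : ptree lab up dn E) i j x :
  E i j -> connect E i x -> connect E x j -> i != x -> x = j.
Proof.
move=> ij ix xj ne; have [C h] := pt_cut P ij; have [Cj Ci _ _ _] := h.
have [Cx|Cx] := boolP (C x).
  by have /andP[_ jx] := cut_cross h ix Ci Cx; apply: (connect_anti P).
have /andP[xi _] := cut_cross h xj Cx Cj.
by move/eqP: ne; case; apply: (connect_anti P).
Qed.

Lemma common_extension_eq lab up dn E E' pos :
  ptree lab up dn E -> ptree lab up dn E' -> extends E pos -> extends E' pos ->
  E =2 E'.
Proof.
move=> P P' e e'.
have sub F F' : ptree lab up dn F -> ptree lab up dn F' ->
    subrel F (connect F') -> subrel F' (connect F) -> subrel F F'.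
  move=> Q Q' FF' F'F i j ij.
  have [x ix xj] := connect_first (FF' _ _ ij) (ptree_neq Q ij).
  rewrite -(cover_edge Q ij (F'F _ _ ix) (connect_sub F'F xj)) //.
  exact: (ptree_neq Q' ix).
have s := common_extension_edge P P' e e'.
have s' := common_extension_edge P' P e' e.
by move=> i j; apply/idP/idP; apply: sub.
Qed.

(** * Rotations *)

Section Reversal.
Variables (lab : V -> int) (up dn : pred V) (E : rel V) (i j : V).

(** Which edges are moved between [i] and [j] is left open. In this form the same
    lemma compares a rotation to the original tree and the original tree to its
    rotation. *)
Variant reversal_step x y : Prop :=
| ReversalKept of E x y & (x, y) <> (i, j)
| ReversalEdge of x = j & y = i
| ReversalLower of E x i & y = j
| ReversalUpper of x = i & E j y.

Variable E' : rel V.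
Hypotheses (P : ptree lab up dn E) (Eij : E i j) (lij : (lab i < lab j)%R).
Hypothesis step : forall x y, E' x y -> reversal_step x y.

(** A path of [E'] through the reversed edge [j -> i] whose ends are not related
    in [E] starts at [j] or arrives there from a child other than [i], hence
    from the right of [j]; it stops at [i] or leaves towards a parent other than
    [j], hence to the left of [i]. So it goes from a label at least that of [j]
    to one at most that of [i]. *)
Lemma reversal_mono x y : connect E' x y ->
  connect E x y \/ [/\ connect E x j, connect E i y & (lab y < lab x)%R].
Proof.
move=> rxy.
have side_i p : E i p -> p != j -> connect E p y -> (lab y < lab i)%R.
  move=> ip pj py; have [D h] := pt_cut P ip.
  have Dy : D y by apply: cut_up (h) py _; case: h.
  have [ui ni] := parents_opposite P ip Eij pj.
  have : lab i <> lab y.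
    by case: h => _ Di _ _ _; move/(pt_inj P) => e; move: Di; rewrite e Dy.
  by case: h => _ _ _ /(_ ui y Dy); move: lij ni; clear; lia.
have side_j c : E c j -> c != i -> connect E x c -> (lab j <= lab x)%R.
  move=> cj ci xc; have [D h] := pt_cut P cj.
  have Dx : ~~ D x by apply: cut_down (h) xc _; case: h.
  have [dj nj] := children_opposite P cj Eij ci.
  case: h => _ _ _ _ /(_ dj x Dx); move: lij nj; clear; lia.
(* invariant along the path, z being its current vertex *)
pose W z := connect E x z \/ [/\ connect E x j, (lab j <= lab x)%R &
  z = i \/ exists p, [/\ E i p, p != j & connect E p z]].
have WW : W y; last first.
  case: WW => [h|[xj jx [->|[p [ip pj py]]]]]; first by left.
    by right; split=> //; move: lij jx; clear; lia.
  right; split=> //; first exact: connect_trans (connect1 ip) py.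
  by have := side_i p ip pj py; move: lij jx; clear; lia.
apply: (connect_ind (W := W) rxy) => {rxy side_i}; first by left.
have eqi := ptree_neq P Eij.
move=> {}y z _ yz [xy|[xj jx hy]].
  case/step: yz => [yz _|ey ez|yi ->|ey jz].
  - by left; apply: connect_trans xy (connect1 yz).
  - rewrite ez; rewrite ey in xy.
    have [e|xj] := eqVneq x j; first by right; rewrite e; split=> //; left.
    have [c cj xc] := connect_last xy xj.
    have [e|ci] := eqVneq c i; first by left; rewrite -e.
    by right; split=> //; [exact: side_j cj ci xc | left].
  - left; apply: connect_trans xy _; apply: connect_trans (connect1 yi) _.
    exact: connect1.
  left; apply: connect_trans xy _; rewrite ey; apply: connect_trans (connect1 Eij) _.
  exact: connect1.
case/step: yz => [yz nij|ey ez|yi _|ey jz].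
- right; split=> //; right; case: hy => [ey|[p [ip pj py]]].
    rewrite ey in yz nij; exists z; split=> //.
    by apply/eqP => ez; rewrite ez in nij.
  by exists p; split=> //; apply: connect_trans py (connect1 yz).
- case: hy => [ey'|[p [ip pj py]]]; first by rewrite -ey ey' eqxx in eqi.
  have ip' := ptree_neq P ip; rewrite ey in py.
  by rewrite (cover_edge P Eij (connect1 ip) py ip') eqxx in pj.
- case: hy => [ey'|[p [ip pj py]]].
    by rewrite ey' (negPf (ptree_irr P i)) in yi.
  by have := edge_nconnect P yi; rewrite (connect_trans (connect1 ip) py).
by left; apply: connect_trans xj _; apply: connect1.
Qed.

End Reversal.

Section Rotation.
Variables (lab : V -> int) (up dn : pred V) (E : rel V) (i j : V).

Definition lower_moved : pred V := fun b => E b i && (dn i ==> (lab i < lab b)%R).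
Definition upper_moved : pred V := fun a => E j a && (up j ==> (lab a < lab j)%R).

Definition rotation : rel V := fun x y =>
  [|| E x y && ~~ [|| (x == i) && (y == j), lower_moved x && (y == i)
                    | (x == j) && upper_moved y],
      (x == j) && (y == i), lower_moved x && (y == j) | (x == i) && upper_moved y].

Variant rotation_spec x y : Prop :=
| RotOld of E x y & (x, y) <> (i, j) & (y = i -> ~~ lower_moved x)
    & (x = j -> ~~ upper_moved y)
| RotNew of x = j & y = i
| RotLower of lower_moved x & y = j
| RotUpper of x = i & upper_moved y.

Lemma rotationP x y : rotation x y -> rotation_spec x y.
Proof.
case/or4P => [/andP[xy]|/andP[/eqP-> /eqP->]|/andP[h /eqP->]|/andP[/eqP-> h]].
- rewrite !negb_or => /and3P[h1 h2 h3]; apply: RotOld => //.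
  + by case=> e1 e2; move: h1; rewrite e1 e2 !eqxx.
  + by move=> e; rewrite e eqxx andbT in h2.
  by move=> e; rewrite e eqxx in h3.
- exact: RotNew.
- exact: RotLower.
exact: RotUpper.
Qed.

Hypothesis P : ptree lab up dn E.

Lemma lower_moved_uniq b b' : lower_moved b -> lower_moved b' -> b = b'.
Proof.
move=> /andP[bi h] /andP[bi' h']; apply: (pt_children P bi bi') => di.
by move: h h'; rewrite di /= => -> ->.
Qed.

Lemma upper_moved_uniq a a' : upper_moved a -> upper_moved a' -> a = a'.
Proof.
move=> /andP[aj h] /andP[aj' h']; apply: (pt_parents P aj aj') => uj.
by move: h h'; rewrite uj /=; clear; lia.
Qed.

End Rotation.

Lemma rotation_step lab up dn E i j x y :
  rotation lab up dn E i j x y -> reversal_step E i j x y.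
Proof.
case/rotationP => [xy ne _ _|-> ->|/andP[xi _] ->|-> /andP[jy _]].
- exact: ReversalKept.
- exact: ReversalEdge.
- exact: ReversalLower.
exact: ReversalUpper.
Qed.

Lemma rotation_step_back lab up dn E i j x y : ptree lab up dn E -> E i j ->
  E x y -> reversal_step (rotation lab up dn E i j) j i x y.
Proof.
move=> P Eij xy; have nji : (x, y) <> (j, i).
  by case=> ex ey; have := edge_nconnect P Eij; rewrite -ex -ey (connect1 xy).
have [/andP[/eqP-> /eqP->]|n1] := boolP ((x == i) && (y == j)).
  exact: ReversalEdge.
have [/andP[lx /eqP->]|n2] := boolP (lower_moved lab dn E i x && (y == i)).
  by apply: ReversalLower; rewrite // /rotation lx eqxx !orbT.
have [/andP[/eqP-> uy]|n3] := boolP ((x == j) && upper_moved lab up E j y).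
  by apply: ReversalUpper; rewrite // /rotation uy eqxx !orbT.
by apply: ReversalKept; rewrite // /rotation xy !negb_or n1 n2 n3.
Qed.

Lemma eq_ptree lab up dn E E' : E =2 E' -> ptree lab up dn E -> ptree lab up dn E'.
Proof.
move=> e [I c C p ch]; split=> //.
- by move=> x y; rewrite -(eq_connect (e := adjacent E)) // => a b; rewrite /adjacent !e.
- move=> x y; rewrite -e => /C[D [Dy Dx nD Ux Dyy]]; exists D; split=> // a b.
  by rewrite -e; apply: nD.
- by move=> x y z; rewrite -!e; apply: p.
by move=> x y z; rewrite -!e; apply: ch.
Qed.

(** Turning the picture by 180 degrees exchanges the two moved subtrees, and an
    increasing rotation remains increasing. *)
Lemma rotation_half_turn lab up dn E i j :
  opposite (rotation lab up dn E i j)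
    =2 rotation (fun x => - lab x)%R dn up (opposite E) j i.
Proof.
have lE x : lower_moved (fun x => - lab x)%R up (opposite E) j x
    = upper_moved lab up E j x.
  by rewrite /lower_moved /upper_moved ltrN2.
have uE x : upper_moved (fun x => - lab x)%R dn (opposite E) i x
    = lower_moved lab dn E i x.
  by rewrite /lower_moved /upper_moved ltrN2.
move=> x y; rewrite /rotation lE uE /opposite.
by case: (E y x); case: (y == i); case: (x == j); case: (x == i); case: (y == j);
  case: (lower_moved _ _ _ _ _); case: (upper_moved _ _ _ _ _).
Qed.

Section RotationPtree.
Variables (lab : V -> int) (up dn : pred V) (E : rel V) (i j : V).
Hypotheses (P : ptree lab up dn E) (Eij : E i j) (lij : (lab i < lab j)%R).
Let R := rotation lab up dn E i j.
Let lower := lower_moved lab dn E i.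
Let upper := upper_moved lab up E j.

(** [CB] is the complement of the moved descendant subtree of [i], and below [CA]
    is the moved ancestor subtree of [j]. Stating the properties used, instead
    of choosing the root of the subtree, covers the case where it is a leaf. *)
Definition lower_cut (CB : pred V) : Prop :=
  [/\ CB i, forall u v, E u v -> ~~ (lower u && (v == i)) -> CB u = CB v,
      forall b, lower b -> edge_cut lab up dn E b i CB
    & forall z, ~~ CB z -> exists b, lower b].

Definition upper_cut (CA : pred V) : Prop :=
  [/\ ~~ CA j, forall u v, E u v -> ~~ ((u == j) && upper v) -> CA u = CA v,
      forall a, upper a -> edge_cut lab up dn E j a CA
    & forall z, CA z -> exists a, upper a].

Lemma lower_cut_exists : exists CB, lower_cut CB.
Proof.
have [b lb|nl] := pickP lower; last by exists predT; split=> // b; rewrite nl.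
have bi : E b i by case/andP: lb.
have [C h] := pt_cut P bi; have [Ci Cb nC _ _] := h.
exists C; split=> //.
- move=> u v uv ne; apply: nC => //; apply: contraNneq ne => -[-> ->].
  by rewrite lb eqxx.
- by move=> b' lb'; rewrite (lower_moved_uniq P lb' lb).
by exists b.
Qed.

Lemma upper_cut_exists : exists CA, upper_cut CA.
Proof.
have [a ua|nu] := pickP upper; last by exists pred0; split=> // a; rewrite nu.
have ja : E j a by case/andP: ua.
have [C h] := pt_cut P ja; have [Ca Cj nC _ _] := h.
exists C; split=> //.
- move=> u v uv ne; apply: nC => //; apply: contraNneq ne => -[-> ->].
  by rewrite ua eqxx.
- by move=> a' ua'; rewrite (upper_moved_uniq P ua' ua).
by exists a.
Qed.

Let Eji : ~~ E j i.
Proof. by apply: contra (edge_nconnect P Eij); apply: connect1. Qed.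
Let nij : i != j. Proof. exact: (ptree_neq P Eij). Qed.
Let lower_j : lower j = false. Proof. by rewrite /lower /lower_moved (negPf Eji). Qed.
Let lower_i : lower i = false.
Proof. by rewrite /lower /lower_moved (negPf (ptree_irr P i)). Qed.

Lemma rotation_conn x y : connect (adjacent R) x y.
Proof.
have sym : connect_sym (adjacent R).
  by apply: sym_connect_sym => a b; rewrite /adjacent orbC.
have ji : R j i by rewrite /R /rotation !eqxx orbT.
have sub a b : E a b -> connect (adjacent R) a b.
  move=> ab; have [/andP[/eqP-> /eqP->]|h1] := boolP ((a == i) && (b == j)).
    by rewrite sym connect1 // /adjacent ji.
  have [/andP[la /eqP->]|h2] := boolP (lower a && (b == i)).
    apply: (@connect_trans _ _ j); apply: connect1; rewrite /adjacent ?ji //.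
    by rewrite /R /rotation (la : lower_moved _ _ _ _ _) eqxx !orbT.
  have [/andP[/eqP-> ub]|h3] := boolP ((a == j) && upper b).
    apply: (@connect_trans _ _ i); apply: connect1; rewrite /adjacent ?ji //.
    by rewrite /R /rotation (ub : upper_moved _ _ _ _ _) eqxx !orbT.
  by apply: connect1; rewrite /adjacent /R /rotation ab !negb_or h1 h2 h3.
apply: connect_sub (pt_conn P x y) => a b /orP[/sub //|/sub]; by rewrite sym.
Qed.

(** The new edges join vertices that were linked in [E] by a path of edges
    incident to [i] or [j] other than [x -> y], so the old cut serves again. *)
Lemma old_edge_cut x y C : edge_cut lab up dn E x y C ->
    (x, y) != (i, j) -> ~~ (lower x && (y == i)) -> ~~ ((x == j) && upper y) ->
  edge_cut lab up dn R x y C.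
Proof.
move=> [Cy Cx nC Ux Dy] n1 n2 n3; split=> //.
have Cij : C i = C j by apply: nC => //; rewrite eq_sym.
move=> u v /rotationP[uv _ _ _|-> ->|lu ->|-> uv] ne.
- exact: nC.
- by [].
- rewrite -Cij; apply: nC; first by case/andP: lu.
  by apply: contraNneq n2 => -[<- <-]; rewrite eqxx andbT.
rewrite Cij; apply: nC; first by case/andP: uv.
by apply: contraNneq n3 => -[<- <-]; rewrite eqxx.
Qed.

(** The subtree at [b] is unchanged when it is moved from [i] to [j]; it is on
    the left of [j] because it was in the same branch of [j] as [i]. *)
Lemma lower_edge_cut b CB : lower b -> lower_cut CB -> edge_cut lab up dn R b j CB.
Proof.
move=> lb [CBi nC cB _]; have [_ CBb _ Ub _] := cB _ lb.
have CBj : CB j by rewrite -(nC _ _ Eij) ?lower_i.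
have Ebi : E b i by case/andP: lb.
split=> //.
- move=> u v /rotationP[uv h1 h2 h3|-> ->|lu ->|-> uv] ne.
  + apply: nC => //; apply/negP => /andP[lu /eqP ev].
    by have := h2 ev; rewrite (lu : lower_moved _ _ _ _ _).
  + by rewrite CBi CBj.
  + by rewrite (lower_moved_uniq P lu lb) eqxx in ne.
  rewrite CBi -CBj; apply: nC; first by case/andP: uv.
  by rewrite lower_j.
- by move=> ub z Cz; rewrite (Ub ub z Cz) (Ub ub j CBj).
move=> dj z CBz; have [C h] := pt_cut P Eij; have [Cj Ci nCij _ Dj] := h.
(* the moved subtree is contained in the side of i *)
have CW u : ~~ CB u -> ~~ C u.
  move=> CBu; have : C i && ~~ CB i = C u && ~~ CB u.
    apply: (uncrossed_const P (W := fun w => C w && ~~ CB w)) => p q pq.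
    have [[-> ->]|ne] := eqVneq (p, q) (i, j); first by rewrite CBi CBj !andbF.
    have [/andP[lp /eqP eq]|ne'] := boolP (lower p && (q == i)).
      by rewrite (nCij _ _ pq ne) eq (negPf Ci).
    by rewrite (nC _ _ pq ne') (nCij _ _ pq ne).
  by rewrite CBu (negPf Ci) /= andbT => <-.
by rewrite (Dj dj z (CW _ CBz)) (Dj dj b (CW _ CBb)).
Qed.

(** The vertices on the side of [j] that are not moved to [i] are [j] and its
    branches other than those of [i] and of the moved ancestor subtree. These
    two are the branches on the left of [j], so the others are on its right. *)
Lemma middle_side C CA z : edge_cut lab up dn E i j C -> upper_cut CA ->
  C z -> ~~ CA z -> dn i -> (lab i < lab z)%R.
Proof.
move=> h [_ _ cA _] Cz CAz di.
have [<-//|jz] := eqVneq j z.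
suff : (lab j < lab z)%R by move: lij; clear; lia.
have [y jy b] := branch_exists P jz.
case/orP: jy => jy.
  have [uy|ny] := boolP (upper y); first by rewrite (branch_cut (cA y uy) b) in CAz.
  move: ny; rewrite /upper /upper_moved jy negb_imply => /andP[uj ny].
  have := parent_side P jy uj b; have := lab_neq P (ptree_neq P jy).
  by move: lij ny; clear; lia.
have [yi|yi] := eqVneq y i.
  by rewrite yi in b; rewrite (negPf (branch_cutN h b)) in Cz.
have [dj nj] := children_opposite P jy Eij yi.
by rewrite (child_side P jy dj b); move: nj lij; clear; lia.
Qed.

(** Only [i], [j] and the root of the moved descendant subtree have new parents.
    Each new parent is on the same side as the one that it replaces; [i] takes
    the place of the moved ancestor subtree, as left or only parent of [j]. *)
Lemma rotation_parents x y z : R x y -> R x z ->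
  (up x -> (lab x < lab y)%R = (lab x < lab z)%R) -> y = z.
Proof.
have old_new u : E j u -> (j = j -> ~~ upper u) ->
    (up j -> (lab j < lab u)%R = (lab j < lab i)%R) -> False.
  move=> ju /(_ erefl); rewrite /upper /upper_moved ju negb_imply => /andP[uj lu] /(_ uj).
  by have := lab_neq P (ptree_neq P ju); move: lij lu; clear; lia.
have old_lower w u : E w u -> (u = i -> ~~ lower w) -> lower w ->
    (up w -> (lab w < lab u)%R = (lab w < lab j)%R) -> False.
  move=> wu nl lw lr; have wi : E w i by case/andP: lw.
  suff /nl : u = i by rewrite lw.
  apply: (pt_parents P wu wi) => uw; rewrite lr //.
  have [C h] := pt_cut P wi; have [Ci _ _ /(_ uw) Uw _] := h.
  by rewrite Uw //; apply: cut_up h (connect1 Eij) Ci.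
have old_upper u v : E i u -> (i, u) <> (i, j) -> upper v ->
    (up i -> (lab i < lab u)%R = (lab i < lab v)%R) -> False.
  move=> iu ne uv lr; apply: ne; congr pair; apply: (pt_parents P iu Eij) => ui.
  have [C [Cj Ci nC /(_ ui) Ui _]] := pt_cut P Eij.
  rewrite lr // Ui // -(nC j) //; first by case/andP: uv.
  by rewrite xpair_eqE eq_sym (negPf nij).
case/rotationP=> [xy n1 l1 u1|ex ey|lx ey|ex uy];
  case/rotationP=> [xz n2 l2 u2|ex' ez|lx' ez|ex' uz] lr.
- exact: (pt_parents P xy xz).
- by rewrite ex' ez in xy u1 lr *; case: (old_new y).
- by rewrite ez in lr; case: (old_lower x y).
- by rewrite ex' in xy n1 lr; case: (old_upper y z).
- by rewrite ex ey in xz u2 lr *; case: (old_new z) => // /lr.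
- by rewrite ey ez.
- by have := lower_j; rewrite -ex /lower lx'.
- by have := nij; rewrite -ex -ex' eqxx.
- by rewrite ey in lr; case: (old_lower x z) => // /lr.
- by have := lower_j; rewrite -ex' /lower lx.
- by rewrite ey ez.
- by have := lower_i; rewrite -ex' /lower lx.
- by rewrite ex in xz n2 lr; case: (old_upper z y) => // /lr.
- by have := nij; rewrite -ex -ex' eqxx.
- by have := lower_i; rewrite -ex /lower lx'.
exact: (upper_moved_uniq P uy uz).
Qed.

End RotationPtree.

Lemma lower_cut_half_turn lab up dn E i CB : injective lab ->
  lower_cut lab up dn E i CB ->
  upper_cut (fun x => - lab x)%R dn up (opposite E) i (predC CB).
Proof.
move=> inj [CBi nC cB eB]; split=> /=.
- by rewrite negbK.
- move=> u v uv ne; rewrite (nC v u) //; apply: contra ne => /andP[lv ->] /=.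
  by move: lv; rewrite /lower_moved /upper_moved ltrN2.
- move=> a ua; have la : lower_moved lab dn E i a.
    by move: ua; rewrite /lower_moved /upper_moved ltrN2.
  by apply/(edge_cut_mirror _ _ _ _ _ _ inj); apply: edge_cut_flip; apply: cB.
move=> z /eB[b lb]; exists b.
by move: lb; rewrite /lower_moved /upper_moved ltrN2.
Qed.

Lemma rotation_ptree lab up dn E i j :
  ptree lab up dn E -> E i j -> (lab i < lab j)%R ->
  ptree lab up dn (rotation lab up dn E i j).
Proof.
move=> P Eij lij; set R := rotation _ _ _ _ _ _.
have inj := pt_inj P.
have P' := ptree_mirror (ptree_flip P).
have lij' : (- lab j < - lab i)%R by rewrite ltrN2.
have Eij' : opposite E j i by [].
have RE := rotation_half_turn lab up dn E i j.
have nij := ptree_neq P Eij.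
split=> //; first exact: (rotation_conn i j P).
- move=> x y xy; case: (rotationP (xy : rotation _ _ _ _ _ _ _ _)).
  + move=> Exy n1 n2 n3; have [C h] := pt_cut P Exy; exists C.
    apply: (old_edge_cut Eij) => //; first exact/eqP.
      by apply/negP => /andP[lx /eqP /n2]; rewrite lx.
    by apply/negP => /andP[/eqP /n3 /negPf->].
  + move=> -> ->; have [CB hB] := lower_cut_exists i P.
    have [CA hA] := upper_cut_exists j P.
    have [C h] := pt_cut P Eij; have [Cj Ci nC _ _] := h.
    have [CBi nB cB eB] := hB; have [CAj nA cA eA] := hA.
    have Eji : ~~ E j i by apply: contra (edge_nconnect P Eij); apply: connect1.
    have CAi : ~~ CA i by rewrite (nA _ _ Eij) // negb_and (negPf nij).
    have CBj : CB j.
      by rewrite -(nB _ _ Eij) // negb_and [j == i]eq_sym (negPf nij) orbT.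
    (* the new side of i: it lost the descendant subtree, won the ancestor one *)
    exists (fun z => ~~ C z && CB z || CA z); split.
    * by rewrite Ci CBi.
    * by rewrite Cj (negPf CAj).
    * move=> u v /rotationP[uv h1 h2 h3|-> ->|lu ->|-> uv] ne.
      - rewrite (nC _ _ uv) ?(nB _ _ uv) ?(nA _ _ uv) //; last exact/eqP.
          by apply/negP => /andP[/eqP /h3 /negPf->].
        by apply/negP => /andP[lx /eqP /h2]; rewrite lx.
      - by rewrite eqxx in ne.
      - have ui : E u i by case/andP: lu.
        have [_ /negPf-> _ _ _] := cB _ lu.
        rewrite Cj (negPf CAj) andbF /= (nA _ _ ui) ?(negPf CAi) //.
        by apply/negP => /andP[_]; rewrite /upper_moved (negPf Eji).
      by have [-> _ _ _ _] := cA _ uv; rewrite Ci CBi orbT.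
    * move=> uj z /orP[/andP[Cz CBz]|CAz].
        have hB' := lower_cut_half_turn inj hB.
        have h' := edge_cut_flip h; move/(edge_cut_mirror _ _ _ _ _ _ inj) in h'.
        have := middle_side P' Eij' lij' h' hB' Cz; rewrite /= negbK => /(_ CBz uj).
        move: lij; clear; lia.
      have [a ua] := eA _ CAz; have [Ca _ _ /(_ uj) Ua _] := cA a ua.
      by rewrite (Ua z CAz); move: lij ua; rewrite /upper_moved uj /=; clear; lia.
    move=> di z; rewrite negb_or negb_and negbK => /andP[/orP[Cz|CBz] CAz].
      by rewrite lij (middle_side P Eij lij h hA Cz CAz di).
    have [b lb] := eB _ CBz; have [_ _ _ _ /(_ di) Db] := cB b lb.
    by rewrite lij (Db z CBz); move: lb; rewrite /lower_moved di /= => /andP[].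
  + move=> lx ->; have [CB hB] := lower_cut_exists i P.
    by exists CB; apply: lower_edge_cut.
  move=> -> uy; have [CB hB] := lower_cut_exists j P'.
  have ly : lower_moved (fun x => - lab x)%R up (opposite E) j y.
    by move: uy; rewrite /lower_moved /upper_moved ltrN2.
  have h := lower_edge_cut P' Eij' ly hB.
  exists (predC CB); apply: (@eq_edge_cut _ _ _ (opposite (opposite R))) => //.
  apply: edge_cut_flip; apply/(edge_cut_mirror _ _ _ _ _ _ inj).
  by apply: eq_edge_cut h => a b; rewrite -RE.
- exact: rotation_parents.
move=> x y z yx zx h.
apply: (rotation_parents P' Eij' lij' (x := x)); rewrite -?RE //.
have Rneq w : R w x -> lab x <> lab w.
  move=> wx /inj e; move: wx; rewrite {}e.
  case/rotationP=> [ww _ _ _|-> e|/andP[wi _] e|e /andP[jw _]].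
  - by rewrite (negPf (ptree_irr P w)) in ww.
  - by rewrite e eqxx in nij.
  - by have := edge_nconnect P Eij; rewrite -e (connect1 wi).
  by have := edge_nconnect P Eij; rewrite -e (connect1 jw).
by move=> /h; have := Rneq _ yx; have := Rneq _ zx; clear; lia.
Qed.

(** * Dangling edges and grafting *)

(** [x] carries an outgoing dangling edge. For the incoming ones, use
    [opposite E] and [dn]. *)
Definition free_above lab up E x : bool :=
  if up x then
    ~~ ([exists y, E x y && (lab y < lab x)%R] && [exists y, E x y && (lab x < lab y)%R])
  else ~~ [exists y, E x y].

Definition last_free lab up E r : Prop :=
  free_above lab up E r /\ forall x, free_above lab up E x -> (lab x <= lab r)%R.

Lemma free_above_mirror lab up E x :
  free_above (fun z => - lab z)%R up E x = free_above lab up E x.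
Proof.
rewrite /free_above andbC; congr (if _ then ~~ (_ && _) else _);
  by apply: eq_existsb => y; rewrite ltrN2.
Qed.

Section LastFree.
Variables (lab : V -> int) (up dn : pred V) (E : rel V).
Hypothesis P : ptree lab up dn E.

Lemma sink_free s : (forall z, ~~ E s z) -> free_above lab up E s.
Proof.
move=> h; rewrite /free_above; case: (up s).
  by rewrite negb_and; apply/orP; left; apply/existsPn => y; rewrite (negPf (h y)).
by apply/existsPn.
Qed.

Lemma last_free_exists (x : V) : exists r, last_free lab up E r.
Proof.
have [s _ hs] := sink_above P x; have fs := sink_free hs.
case: (@Order.TotalTheory.arg_maxP _ _ _ s (free_above lab up E) lab fs) => r fr hr.
by exists r.
Qed.

Variable r : V.
Hypothesis top : last_free lab up E r.

(** Above a right parent of [x] there is a sink, which is dangling, and it is on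
    the right of [x]. *)
Lemma no_right_parent x y : up x -> E x y -> (lab x < lab y)%R -> (lab x < lab r)%R.
Proof.
move=> ux xy lxy; have [s ys hs] := sink_above P y.
have [C h] := pt_cut P xy; have [Cy Cx _ /(_ ux) Ux _] := h.
have := Ux s (cut_up h ys Cy); have := top.2 _ (sink_free hs).
by move: lxy; clear; lia.
Qed.

Lemma up_le_last x : up x -> (lab x <= lab r)%R.
Proof.
move=> ux; have [/(top.2 _) //|] := boolP (free_above lab up E x).
rewrite /free_above ux negbK => /andP[_ /existsP[y /andP[xy lxy]]].
exact: ltW (no_right_parent ux xy lxy).
Qed.

Lemma last_parent y : E r y -> up r && (lab y < lab r)%R.
Proof.
move=> ry; have ur : up r.
  move: (top.1); rewrite /free_above; case: (up r) => // /existsPn /(_ y).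
  by rewrite ry.
rewrite ur /=; have := lab_neq P (ptree_neq P ry).
have : ~~ (lab r < lab y)%R.
  by apply/negP => /(no_right_parent ur ry); rewrite ltxx.
by clear; lia.
Qed.

(** The path from [r] to [q] cannot start upwards, since the parents of [r] lead
    to its left. If it starts downwards without being directed, its first valley
    is a vertex with two parents on the right of [r], against [up_le_last]. *)
Lemma right_below_last q : (lab r < lab q)%R -> connect E q r.
Proof.
move=> rq; have nrq : r != q by apply: contraTneq rq => ->; rewrite ltxx.
have [y ry b] := branch_exists P nrq.
case/orP: ry => ry.
  have /andP[ur lr] := last_parent ry.
  by have := parent_side P ry ur b; move: rq lr; clear; lia.
have [qy|[k [uk _ bk]]] := turn_down P ry b.
  exact: connect_trans qy (connect1 ry).
by have := up_le_last uk; move: bk rq; rewrite /between; clear; lia.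
Qed.

(** The next two lemmas say that adding vertices on the right of all the others,
    on the side of [r] of every cut, respects the label conditions. *)
Lemma last_cut_up x y C : edge_cut lab up dn E x y C -> up x -> C r ->
  (lab x < lab y)%R.
Proof.
move=> [Cy Cx _ Ux _] ux Cr; rewrite -(Ux ux r Cr).
have : lab x <> lab r.
  by move/(pt_inj P) => e; rewrite e Cr in Cx.
by have := up_le_last ux; clear; lia.
Qed.

Lemma last_cut_down x y C : edge_cut lab up dn E x y C -> dn y -> ~~ C r ->
  (lab y < lab x)%R.
Proof.
move=> h dy Cr; have [Cy Cx _ _ Dy] := h; rewrite -(Dy dy r Cr).
have : lab y <> lab r.
  by move/(pt_inj P) => e; rewrite -e Cy in Cr.
have : ~~ (lab r < lab y)%R.
  by apply: contra Cr => /right_below_last yr; apply: cut_up h yr Cy.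
by clear; lia.
Qed.

End LastFree.
End AbstractPermutrees.

Definition ord_lab n (i : 'I_n) : int := Posz i.

Lemma ord_lab_inj n : injective (@ord_lab n).
Proof. by move=> i j [/ord_inj]. Qed.

Lemma ptree_half_turn n (up dn : pred 'I_n) (E : rel 'I_n) :
  ptree (@ord_lab n) up dn E ->
  ptree (fun x => - @ord_lab n x)%R dn up (opposite E).
Proof. by move=> P; apply: ptree_mirror; apply: ptree_flip. Qed.

(** One graft is enough: with all edges reversed, T / T' is obtained from the
    reversals of T and T' exactly as T \ T' is from T and T'. *)
Section Graft.
Variables (n m : nat) (up1 dn1 : pred 'I_n) (E1 : rel 'I_n).
Variables (up2 dn2 : pred 'I_m) (E2 : rel 'I_m).
Variables (up dn : pred 'I_(n + m)) (E : rel 'I_(n + m)).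
Hypotheses (P1 : ptree (@ord_lab n) up1 dn1 E1)
  (P2 : ptree (@ord_lab m) up2 dn2 E2).
Hypotheses (upl : forall x, up (lshift m x) = up1 x)
  (upr : forall x, up (rshift n x) = up2 x).
Hypotheses (dnl : forall x, dn (lshift m x) = dn1 x)
  (dnr : forall x, dn (rshift n x) = dn2 x).
Hypotheses (Ell : forall x y, E (lshift m x) (lshift m y) = E1 x y)
  (Err : forall x y, E (rshift n x) (rshift n y) = E2 x y)
  (Elr : forall x y, E (lshift m x) (rshift n y) <->
     last_free (@ord_lab n) up1 E1 x
     /\ last_free (fun y => - @ord_lab m y)%R dn2 (opposite E2) y)
  (Erl : forall x y, E (rshift n y) (lshift m x) = false).

Let lab := @ord_lab (n + m).
Let labll x y : (lab (lshift m x) < lab (lshift m y))%R = (ord_lab x < ord_lab y)%R.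
Proof. by []. Qed.
Let labrr x y : (lab (rshift n x) < lab (rshift n y))%R = (ord_lab x < ord_lab y)%R.
Proof. by rewrite /lab /ord_lab /=; lia. Qed.
Let lablr x y : (lab (lshift m x) < lab (rshift n y))%R = true.
Proof. by rewrite /lab /ord_lab /=; have := ltn_ord x; clear; lia. Qed.
Let labrl x y : (lab (rshift n x) < lab (lshift m y))%R = false.
Proof. by rewrite /lab /ord_lab /=; have := ltn_ord y; clear; lia. Qed.

Definition glue (C1 : pred 'I_n) (C2 : pred 'I_m) : pred 'I_(n + m) :=
  fun w => match split w with inl x => C1 x | inr y => C2 y end.

Lemma glue_l C1 C2 x : glue C1 C2 (lshift m x) = C1 x.
Proof. by rewrite /glue (unsplitK (inl x)). Qed.
Lemma glue_r C1 C2 y : glue C1 C2 (rshift n y) = C2 y.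
Proof. by rewrite /glue (unsplitK (inr y)). Qed.

Let top_uniq x x' : last_free (@ord_lab n) up1 E1 x ->
  last_free (@ord_lab n) up1 E1 x' -> x = x'.
Proof.
move=> [fx hx] [fx' hx']; apply: ord_lab_inj; apply/eqP.
by rewrite eq_le hx' ?hx.
Qed.

Let bot_uniq y y' : last_free (fun y => - @ord_lab m y)%R dn2 (opposite E2) y ->
  last_free (fun y => - @ord_lab m y)%R dn2 (opposite E2) y' -> y = y'.
Proof.
move=> [fy hy] [fy' hy']; apply: ord_lab_inj; apply/eqP.
by rewrite -eqr_opp eq_le hy' ?hy.
Qed.

Lemma graft_conn x y : connect (adjacent E) x y.
Proof.
have sym : connect_sym (adjacent E).
  by apply: sym_connect_sym => a b; rewrite /adjacent orbC.
have ll a b : connect (adjacent E) (lshift m a) (lshift m b).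
  apply: (connect_ind (W := fun b => connect (adjacent E) (lshift m a) (lshift m b))
    (pt_conn P1 a b)) => // u v _ uv au.
  by apply: connect_trans au (connect1 _); rewrite /adjacent !Ell.
have rr a b : connect (adjacent E) (rshift n a) (rshift n b).
  apply: (connect_ind (W := fun b => connect (adjacent E) (rshift n a) (rshift n b))
    (pt_conn P2 a b)) => // u v _ uv au.
  by apply: connect_trans au (connect1 _); rewrite /adjacent !Err.
have lr a b : connect (adjacent E) (lshift m a) (rshift n b).
  have [r hr] := last_free_exists P1 a.
  have [l hl] := last_free_exists (ptree_half_turn P2) b.
  apply: connect_trans (ll a r) _; apply: connect_trans (rr l b).
  by apply: connect1; apply/orP; left; apply/Elr.
case: (split_ordP x) => a ->; case: (split_ordP y) => b -> //.
by rewrite sym.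
Qed.

(** A cut of one tree is extended to the other one, which stays in one piece, by
    the side of the vertex that carries the new edge. *)
Lemma graft_ptree : ptree lab up dn E.
Proof.
split; [exact: ord_lab_inj | exact: graft_conn | move=> x y xy
  | move=> x y z xy xz h | move=> x y z yx zx h].
- case: (split_ordP x) xy => a ->; case: (split_ordP y) => b ->;
    rewrite ?Erl // ?Ell ?Err => ab.
  + have [C h] := pt_cut P1 ab; have [Cb Ca nC Ux Dy] := h.
    have [r hr] := last_free_exists P1 a.
    exists (glue C (fun=> C r)); split; rewrite ?glue_l //.
    * move=> u v; case: (split_ordP u) => c ->; case: (split_ordP v) => d ->;
        rewrite ?glue_l ?glue_r ?Erl ?Ell //.
        by move=> cd ne; apply: nC => //; apply: contra ne => /eqP[-> ->].
      by move=> /Elr[hc _] _; rewrite (top_uniq hc hr).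
    * rewrite upl => ua z; case: (split_ordP z) => c ->;
        rewrite ?glue_l ?glue_r ?labll ?lablr.
        exact: Ux.
      by move=> Cr; rewrite (last_cut_up P1 hr h).
    rewrite dnl => ub z; case: (split_ordP z) => c ->;
      rewrite ?glue_l ?glue_r ?labll ?lablr.
      exact: Dy.
    by move=> Cr; rewrite (last_cut_down P1 hr h).
  + have /Elr[ha hb] := ab.
    exists (glue (fun=> false) (fun=> true)); split; rewrite ?glue_l ?glue_r //.
    * move=> u v; case: (split_ordP u) => c ->; case: (split_ordP v) => d ->;
        rewrite ?glue_l ?glue_r ?Erl //.
      move=> /Elr[hc hd]; rewrite (top_uniq hc ha) (bot_uniq hd hb).
      by rewrite eqxx.
    * by move=> _ z; case: (split_ordP z) => c ->; rewrite ?glue_l ?glue_r ?lablr.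
    by move=> _ z; case: (split_ordP z) => c ->; rewrite ?glue_l ?glue_r ?labrl.
  have [C h] := pt_cut P2 ab; have [Cb Ca nC Ux Dy] := h.
  have P2' := ptree_half_turn P2.
  have [r hr] := last_free_exists P2' a.
  have h' := edge_cut_flip h.
  move/(edge_cut_mirror _ _ _ _ _ _ (pt_inj P2)) in h'.
  exists (glue (fun=> C r) C); split; rewrite ?glue_r //.
  + move=> u v; case: (split_ordP u) => c ->; case: (split_ordP v) => d ->;
      rewrite ?glue_l ?glue_r ?Erl ?Err //.
      by move=> /Elr[_ hc] _; rewrite (bot_uniq hc hr).
    by move=> cd ne; apply: nC => //; apply: contra ne => /eqP[-> ->].
  + rewrite upr => ua z; case: (split_ordP z) => c ->;
      rewrite ?glue_l ?glue_r ?labrr ?labrl.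
      move=> Cr; have := last_cut_down P2' hr h' ua; rewrite /= negbK => /(_ Cr).
      by clear; lia.
    exact: Ux.
  rewrite dnr => ub z; case: (split_ordP z) => c ->;
    rewrite ?glue_l ?glue_r ?labrr ?labrl.
    by move=> Cr; have := last_cut_up P2' hr h' ub Cr; clear; lia.
  exact: Dy.
- case: (split_ordP x) xy xz h => a ->; rewrite ?upl ?upr;
    case: (split_ordP y) => b ->; case: (split_ordP z) => c ->;
    rewrite ?Erl ?Ell ?Err ?labll ?labrr ?lablr ?labrl //.
  + by move=> ab ac h; rewrite (pt_parents P1 ab ac).
  + move=> ab /Elr[ha _] h.
    have /andP[/h h' lt] := last_parent P1 ha ab.
    by move: lt h'; clear; lia.
  + move=> /Elr[ha _] ab h.
    have /andP[/h h' lt] := last_parent P1 ha ab.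
    by move: lt h'; clear; lia.
  + by move=> /Elr[_ hb] /Elr[_ hc] _; rewrite (bot_uniq hb hc).
  by move=> ab ac h; rewrite (pt_parents P2 ab ac).
case: (split_ordP x) yx zx h => a ->; rewrite ?dnl ?dnr;
  case: (split_ordP y) => b ->; case: (split_ordP z) => c ->;
  rewrite ?Erl ?Ell ?Err ?labll ?labrr ?lablr ?labrl //.
- by move=> ab ac h; rewrite (pt_children P1 ab ac).
- by move=> /Elr[hb _] /Elr[hc _] _; rewrite (top_uniq hb hc).
- move=> /Elr[_ ha] ab h.
  have /andP[/h h' lt] := last_parent (ptree_half_turn P2) ha ab.
  by move: lt h'; clear; lia.
- move=> ab /Elr[_ ha] h.
  have /andP[/h h' lt] := last_parent (ptree_half_turn P2) ha ab.
  by move: lt h'; clear; lia.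
by move=> ab ac h; rewrite (pt_children P2 ab ac).
Qed.

End Graft.

(** * Cuts and the combinatorial definition *)

Section Bridge.
Variable n : nat.
Implicit Types (T : decorated_digraph n) (D : {set 'I_n * 'I_n}).

Definition edge_rel T : rel 'I_n := fun x y => (x, y) \in edges T.
Definition ups T : pred 'I_n := fun i => two_parents (decoration T i).
Definition downs T : pred 'I_n := fun i => two_children (decoration T i).

Definition ptree_of T := ptree (@ord_lab n) (ups T) (downs T) (edge_rel T).

(** A simple cycle through [x] is a path between two distinct neighbors of [x]
    that avoids [x]. *)
Lemma acyclicP D (E : rel 'I_n) : (forall x y, E x y = ((x, y) \in D)) ->
  (forall x, ~~ E x x) ->
  acyclic D <->
  (forall x y w, adjacent E x y -> adjacent E x w -> branch E x y w -> w = y).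
Proof.
move=> ED irr.
have adjE x y : adj D x y = adjacent E x y by rewrite /adjacent !ED.
have adjS x y : adj D x y = adj D y x by rewrite /adj orbC.
split=> [ac x y w xy xw /connectP[p pp ew]|H].
  apply/eqP/negPn/negP => wy.
  case/shortenP: pp ew => q pq uq _ ew.
  have qx : x \notin y :: q.
    have xy' : x != y by apply: contraTneq xy => ->; rewrite /adjacent orbb.
    elim: q y pq {uq ew wy xy} xy' => [|a q IH] y /=; first by rewrite inE => _.
    by move=> /andP[/and3P[_ _ ax] pq] xy'; rewrite inE (negPf xy') IH // eq_sym.
  have cyc : ucycleb (adj D) (x :: y :: q).
    rewrite /ucycleb /= -/(uniq (y :: q)) qx uq adjE xy rcons_path -ew.
    rewrite adjS adjE xw !andbT.
    by apply: sub_path pq => a b /= /and3P[ab _ _]; rewrite adjE.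
  have q0 : 0 < size q by case: q ew {pq uq qx cyc} => //= e; rewrite e eqxx in wy.
  have sz : size (x :: y :: q) < n.+1.
    rewrite ltnS -[X in _ <= X]card_ord; case/andP: cyc => _ /card_uniqP <-.
    exact: max_card.
  move/forallP/(_ (Ordinal sz))/forallP/(_ (in_tuple (x :: y :: q))): ac.
  by rewrite cyc /= !ltnS q0.
apply/forallP => k; apply/forallP => -[c /= /eqP sc]; apply/implyP => k2.
apply/negP => /andP[]; case: c sc => [|x [|y [|z q]]] /= sc; try by rewrite -sc in k2.
rewrite rcons_path => /andP[xy /and3P[yz pq lx]] /and3P[].
rewrite inE negb_or => /andP[xy' xzq] yzq _.
have e : last z q = y.
  apply: (H x); rewrite -?adjE //; first by rewrite adjS.
  have : path (adj D) y (z :: q) by rewrite /= yz.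
  move=> pzq; apply/connectP; exists (z :: q) => //.
  elim: (z :: q) y xy' xzq pzq {xy yz pq lx yzq sc k2} => //= a s IH y.
  rewrite inE negb_or => xy' /andP[xa xs] /andP[ya ps].
  by rewrite -adjE ya !(eq_sym _ x) xy' xa IH.
by rewrite -e mem_last in yzq.
Qed.

Lemma ord_lab_lt (x y : 'I_n) : (ord_lab x < ord_lab y)%R = (x < y).
Proof. by []. Qed.

Lemma ptree_branch_adj E (up dn : pred 'I_n) x y w : ptree (@ord_lab n) up dn E ->
  adjacent E x y -> adjacent E x w -> branch E x y w -> w = y.
Proof.
move=> P.
have key up' dn' F : ptree (@ord_lab n) up' dn' F ->
    F x y -> adjacent F x w -> branch F x y w -> w = y.
  move=> Q xy xw b; have [C h] := pt_cut Q xy; have Cw := branch_cut h b.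
  have [Cy Cx nC _ _] := h; apply/eqP/negPn/negP => wy.
  case/orP: xw => xw.
    by rewrite -(nC _ _ xw) ?(negPf Cx) // in Cw; rewrite xpair_eqE eqxx.
  rewrite (nC _ _ xw) ?(negPf Cx) // in Cw.
  by rewrite xpair_eqE (negPf (ptree_neq Q xy)) andbF.
case/orP => [xy|yx] xw b; first exact: (key _ _ _ P xy xw b).
apply: (key _ _ _ (ptree_flip P) yx); last by rewrite branch_flip.
by move: xw; rewrite /adjacent /opposite orbC.
Qed.

Lemma slots_side T x (A : {set 'I_n}) y z : slots_ok T x true A ->
  y \in A -> y != x -> branch (edge_rel T) x y z -> (x < z) = (x < y).
Proof.
move=> /and3P[_ _ /forall_inP h] yA yx b.
move: (h y yA) => /forall_inP/(_ z); rewrite inE => /(_ b).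
by move: yx; rewrite -val_eqE /=; case: (ltngtP x y) => // _ _; case: (ltngtP x z).
Qed.

Lemma slots_uniq T x two (A : {set 'I_n}) y z : slots_ok T x two A ->
  y \in A -> z \in A -> y != x -> z != x -> (two -> (x < y) = (x < z)) -> y = z.
Proof.
rewrite /slots_ok; case: two => [/and3P[cl cr _]|cA] yA zA yx zx; last first.
  by move=> _; move/card_le1_eqP: cA; apply.
move=> /(_ isT); move: yx zx; rewrite -!val_eqE /=.
case: (ltngtP x y) => // xy _; case: (ltngtP x z) => // xz _ _.
  by move/card_le1_eqP: cr; apply; rewrite inE ?yA ?zA.
by move/card_le1_eqP: cl; apply; rewrite inE ?yA ?zA.
Qed.

Lemma branch_noncross (E : rel 'I_n) x y :
    (forall x y w, adjacent E x y -> adjacent E x w -> branch E x y w -> w = y) ->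
    x != y -> adjacent E x y ->
  forall a b, adjacent E a b -> (a, b) != (x, y) -> (b, a) != (x, y) ->
  branch E x y a = branch E x y b.
Proof.
move=> ac nxy xy.
have bx := branch_root E nxy.
have step a b : adjacent E a b -> (a, b) != (x, y) -> (b, a) != (x, y) ->
    branch E x y a -> branch E x y b.
  move=> ab n1 n2 ya.
  have [ax|ax] := eqVneq a x; first by rewrite ax (negPf bx) in ya.
  have [bx'|bx'] := eqVneq b x.
    rewrite bx' in ab n2; rewrite {1}/adjacent orbC in ab.
    by have e := ac _ _ _ xy ab ya; rewrite e eqxx in n2.
  by apply: connect_trans ya (connect1 _); rewrite /= ab ax.
move=> a b ab n1 n2; apply/idP/idP; first exact: step.
by apply: step => //; rewrite /adjacent orbC.
Qed.

(** The cut of an edge [x -> y] is the branch of [y] at [x]; its complement is the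
    branch of [x] at [y], which gives the condition on the children of [y]. *)
Lemma ptree_of_permutree T : permutree T -> ptree_of T.
Proof.
case/andP=> /and3P[/'forall_'forall_implyP asym /'forall_forallP conn acyc].
move=> /forallP slots.
set E := edge_rel T.
have irr x : ~~ E x x.
  by apply/negP => xx; have := asym x x xx; rewrite (xx : (x, x) \in _).
have neq x y : E x y -> x != y by move=> xy; apply: contraTneq xy => ->.
have ac : forall x y w, adjacent E x y -> adjacent E x w -> branch E x y w -> w = y.
  by apply/(acyclicP (D := edges T)).
have conn' x y : connect (adjacent E) x y by apply: conn.
have adjE x y : E x y -> adjacent E x y by rewrite /adjacent => ->.
have adjE' x y : E x y -> adjacent E y x by rewrite /adjacent orbC => ->.
have nopp x y a b : E x y -> E a b -> (b, a) != (x, y).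
  move=> xy ab; apply: contraTneq ab => -[-> ->]; exact: asym.
have bC x y : E x y -> branch E x y =1 predC (branch E y x).
  move=> xy z.
  have bxx u v (uv : u != v) := branch_root E uv.
  (* every edge but x -> y has its ends in the same branch, for both branches *)
  pose W w := branch E x y w = ~~ branch E y x w.
  have nxy := neq _ _ xy.
  apply: (connect_ind (W := W) (conn' x z)).
    by rewrite /W (negPf (bxx _ _ nxy)) /branch connect0.
  have nc a b : E a b -> (a, b) != (x, y) ->
     branch E x y a = branch E x y b /\ branch E y x a = branch E y x b.
    move=> ab ne; split; apply: branch_noncross => //; try exact: adjE; try exact: adjE'.
    - exact: nopp.
    - by rewrite eq_sym.
    - by have := nopp _ _ _ _ xy ab; apply: contra => /eqP[-> ->].
    by apply: contra ne => /eqP[-> ->].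
  have st a b : E a b -> W a <-> W b.
    move=> ab; have [[-> ->]|ne] := eqVneq (a, b) (x, y).
      have yx : y != x by rewrite eq_sym.
      by rewrite /W (negPf (bxx _ _ nxy)) (negPf (bxx _ _ yx)) /branch !connect0.
    by have [e1 e2] := nc _ _ ab ne; rewrite /W e1 e2.
  by move=> a b _ /orP[/st|/st] h /h.
have up_slots x : slots_ok T x (ups T x) (parents T x) by case/andP: (slots x).
have dn_slots x : slots_ok T x (downs T x) (children T x) by case/andP: (slots x).
split=> //; first exact: ord_lab_inj.
- move=> x y xy; have nxy := neq _ _ xy; exists (branch E x y); split.
  + exact: connect0.
  + by rewrite bC //= negbK; apply: connect0.
  + move=> a b ab ne; apply: branch_noncross => //; try exact: adjE.
    exact: nopp.
  + move=> ux z b; rewrite !ord_lab_lt; apply: slots_side b; last by rewrite eq_sym.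
      by have := up_slots x; rewrite ux; apply.
    by rewrite inE.
  move=> dy z; rewrite bC //= negbK => b.
  rewrite !ord_lab_lt; apply: slots_side b; last by [].
    by have := dn_slots y; rewrite dy; apply.
  by rewrite inE.
- move=> x y z xy xz h; apply: (slots_uniq (up_slots x)); rewrite ?inE // eq_sym;
    exact: neq.
by move=> x y z xy xz h; apply: (slots_uniq (dn_slots x)); rewrite ?inE //; exact: neq.
Qed.

Lemma slots_okI T x (two : bool) (A : {set 'I_n}) :
  (forall y, y \in A -> y != x) ->
  (forall y z, y \in A -> z \in A -> (two -> (x < y) = (x < z)) -> y = z) ->
  (two -> forall y z, y \in A -> branch (edge_rel T) x y z ->
    (z != x) && ((x < z) == (x < y))) ->
  slots_ok T x two A.
Proof.
rewrite /slots_ok; case: two => nA uA sA; last first.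
  by apply/card_le1_eqP => y z yA zA; apply: uA.
apply/and3P; split.
- apply/card_le1_eqP => y z; rewrite inE => /andP[yA yx]; rewrite inE => /andP[zA zx].
  by apply: uA => // _; rewrite [LHS]ltnNge [RHS]ltnNge (ltnW yx) (ltnW zx).
- apply/card_le1_eqP => y z; rewrite inE => /andP[yA yx]; rewrite inE => /andP[zA zx].
  by apply: uA => // _; rewrite yx zx.
apply/forall_inP => y yA; apply/forall_inP => z; rewrite inE => b.
have /andP[] := sA isT y z yA b; have := nA y yA; rewrite -!val_eqE /=.
by case: (ltngtP x y); case: (ltngtP x z).
Qed.

Lemma permutree_of_ptree T : ptree_of T -> permutree T.
Proof.
move=> P; set E := edge_rel T in P.
have conn := pt_conn P.
apply/andP; split.
  apply/and3P; split.
  - apply/'forall_'forall_implyP => x y xy; apply/negP => yx.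
    by have := edge_nconnect P (xy : E x y); rewrite (connect1 (yx : E y x)).
  - by apply/'forall_forallP => x y; apply: conn.
  apply/(acyclicP (E := E)) => //; first exact: (ptree_irr P).
  by move=> x y w; apply: (ptree_branch_adj P).
apply/forallP => x; apply/andP; split; apply: slots_okI.
- by move=> y; rewrite inE eq_sym; apply: (ptree_neq P).
- by move=> y z; rewrite !inE => xy xz; apply: (pt_parents P xy xz).
- move=> ux y z; rewrite inE => xy b; apply/andP; split; last first.
    by have := parent_side P (xy : E x y) ux b; rewrite !ord_lab_lt => ->.
  have [C h] := pt_cut P (xy : E x y); have := branch_cut h b.
  by apply: contraTneq => ->; case: h.
- by move=> y; rewrite inE; apply: (ptree_neq P).
- by move=> y z; rewrite !inE => xy xz; apply: (pt_children P xy xz).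
move=> dx y z; rewrite inE => yx b; apply/andP; split; last first.
  by have := child_side P (yx : E y x) dx b; rewrite !ord_lab_lt => ->.
have [C h] := pt_cut P (yx : E y x); have := branch_cutN h b.
by apply: contraNneq => ->; case: h.
Qed.

Lemma edge_rel_rotate T i j : edge_rel (rotate T i j) =2
  rotation (@ord_lab n) (ups T) (downs T) (edge_rel T) i j.
Proof.
move=> x y; rewrite /edge_rel /rotate /edges /=.
have lE b : b \in rot_B T i = lower_moved (@ord_lab n) (downs T) (edge_rel T) i b.
  by rewrite !inE.
have uE a : a \in rot_A T j = upper_moved (@ord_lab n) (ups T) (edge_rel T) j a.
  by rewrite !inE.
have imB k : ((x, y) \in [set (b, k) | b in rot_B T i]) = (x \in rot_B T i) && (y == k).
  apply/imsetP/andP => [[b bB [-> ->]]|[xB /eqP->]]; first by rewrite eqxx.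
  by exists x.
have imA k : ((x, y) \in [set (k, a) | a in rot_A T j]) = (x == k) && (y \in rot_A T j).
  apply/imsetP/andP => [[a aA [-> ->]]|[/eqP-> yA]]; first by rewrite eqxx.
  by exists y.
rewrite in_setU in_setD !in_setU !in_set1 !imA !imB !lE !uE !xpair_eqE.
by rewrite /rotation /edge_rel /edges andbC -!orbA.
Qed.

Lemma permutree_rotate T i j : permutree T -> (i, j) \in edges T -> i < j ->
  permutree (rotate T i j).
Proof.
move=> /ptree_of_permutree P ij lij; apply: permutree_of_ptree.
apply: (@eq_ptree _ _ _ _ (rotation (@ord_lab n) (ups T) (downs T) (edge_rel T) i j)).
  by move=> x y; rewrite edge_rel_rotate.
exact: rotation_ptree.
Qed.

Lemma increasing_rotationP T S : increasing_rotation T S ->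
  exists i j, [/\ permutree T, permutree S, (i, j) \in edges T, i < j & S = rotate T i j].
Proof.
by move=> /and3P[pT pS /existsP[i /existsP[j /and3P[ij lij /eqP e]]]]; exists i, j.
Qed.

(** The second half is the first one for the reverse move, which is increasing
    after reflection of the labels. *)
Lemma rotate_mono T i j : permutree T -> (i, j) \in edges T -> i < j ->
  (forall x y : 'I_n, x < y ->
     connect (edge_rel (rotate T i j)) x y -> connect (edge_rel T) x y) /\
  (forall x y : 'I_n, y < x ->
     connect (edge_rel T) x y -> connect (edge_rel (rotate T i j)) x y).
Proof.
move=> /ptree_of_permutree P ij lij.
split=> x y lxy; rewrite (eq_connect (edge_rel_rotate T i j)) => c.
  have step := @rotation_step _ (@ord_lab n) (ups T) (downs T) (edge_rel T) i j.
  have [//|[_ _]] := reversal_mono P ij lij step c.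
  by rewrite ord_lab_lt ltnNge ltnW.
have P' := ptree_mirror (rotation_ptree P ij lij).
have ji : rotation (@ord_lab n) (ups T) (downs T) (edge_rel T) i j j i.
  by rewrite /rotation !eqxx orbT.
have [|//|[_ _]] := reversal_mono P' ji _ (fun x y => rotation_step_back P ij) c.
  by rewrite ltrN2.
by rewrite ltrN2 ord_lab_lt ltnNge ltnW.
Qed.

Lemma permutree_le_mono T S : permutree_le T S ->
  [/\ decoration S = decoration T,
      forall x y : 'I_n, x < y -> connect (edge_rel S) x y -> connect (edge_rel T) x y &
      forall x y : 'I_n, y < x -> connect (edge_rel T) x y -> connect (edge_rel S) x y].
Proof.
move=> le; pose W S := [/\ decoration S = decoration T,
  forall x y : 'I_n, x < y -> connect (edge_rel S) x y -> connect (edge_rel T) x y &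
  forall x y : 'I_n, y < x -> connect (edge_rel T) x y -> connect (edge_rel S) x y].
apply: (connect_ind (W := W) le) => // A B _.
case/increasing_rotationP=> i [j [pA _ ij lij ->]].
case=> dA incA decA; have [inc dec] := rotate_mono pA ij lij; split=> //.
  by move=> x y lxy /(inc _ _ lxy); apply: incA.
by move=> x y lxy /(decA _ _ lxy); apply: dec.
Qed.

End Bridge.

Lemma card_free (V : finType) lab up dn (E : rel V) x (A : {set V}) :
  ptree lab up dn E -> (forall y, (y \in A) = E x y) ->
  (#|A| < if up x then 2 else 1) = free_above lab up E x.
Proof.
move=> P AE; rewrite /free_above; case: ifP => ux; last first.
  rewrite ltnS leqn0 cards_eq0; apply/eqP/existsPn => [A0 y|h].
    by rewrite -AE A0 inE.
  by apply/setP => y; rewrite inE AE; apply: negbTE (h y).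
rewrite ltnS; apply/card_le1_eqP/idP => [h|h y z].
  apply/negP => /andP[/existsP[y /andP[xy yx]] /existsP[z /andP[xz zx]]].
  have e : y = z by apply: h; rewrite AE.
  by move: yx; rewrite e ltNge ltW.
rewrite !AE => xy xz; apply: esym; apply: (pt_parents P xy xz) => _.
have := lab_neq P (ptree_neq P xy); have := lab_neq P (ptree_neq P xz) => n1 n2.
apply/idP/idP => l; apply: contraNT h => l'; apply/andP; split; apply/existsP.
- by exists z; rewrite xz; move: n1 l'; clear; lia.
- by exists y; rewrite xy.
- by exists y; rewrite xy; move: n2 l'; clear; lia.
by exists z; rewrite xz.
Qed.

Lemma out_danglingE k (S : decorated_digraph k) x : permutree S ->
  out_dangling S x = free_above (@ord_lab k) (ups S) (edge_rel S) x.
Proof.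
move=> /ptree_of_permutree P; rewrite -(card_free (A := parents S x) P) // => y.
by rewrite inE.
Qed.

Lemma in_danglingE k (S : decorated_digraph k) x : permutree S ->
  in_dangling S x = free_above (@ord_lab k) (downs S) (opposite (edge_rel S)) x.
Proof.
move=> /ptree_of_permutree P.
rewrite -(card_free (A := children S x) (ptree_flip P)) // => y.
by rewrite inE.
Qed.

Lemma rightmostP k (Q : pred 'I_k) up E : Q =1 free_above (@ord_lab k) up E ->
  forall i, rightmost Q i <-> last_free (@ord_lab k) up E i.
Proof.
move=> QE i; rewrite /rightmost QE; split=> [/andP[fi /'forall_implyP h]|[-> h]].
  by split=> // x; rewrite -QE => /h.
by apply/'forall_implyP => x; rewrite QE => /h.
Qed.

Lemma leftmostP k (Q : pred 'I_k) up E : Q =1 free_above (@ord_lab k) up E ->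
  forall i, leftmost Q i <-> last_free (fun x => - @ord_lab k x)%R up E i.
Proof.
move=> QE i; rewrite /leftmost QE /last_free free_above_mirror.
split=> [/andP[fi /'forall_implyP h]|[-> h]].
  by split=> // x; rewrite free_above_mirror -QE lerN2 => /h.
by apply/'forall_implyP => x; rewrite QE -free_above_mirror => /h; rewrite lerN2.
Qed.

Section GraftBridge.
Variables (n m : nat) (T : decorated_digraph n) (T' : decorated_digraph m).
Hypotheses (hT : permutree T) (hT' : permutree T').

Lemma union_ll x y : ((lshift m x, lshift m y) \in union_edges T T') = ((x, y) \in edges T).
Proof.
rewrite inE; apply/orP/idP => [[] /imsetP[[a b] ab /eqP]|xy].
- by rewrite xpair_eqE !eq_shift => /andP[/eqP-> /eqP->].
- by rewrite xpair_eqE !eq_shift.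
by left; apply/imsetP; exists (x, y).
Qed.

Lemma union_rr x y : ((rshift n x, rshift n y) \in union_edges T T') = ((x, y) \in edges T').
Proof.
rewrite inE; apply/orP/idP => [[] /imsetP[[a b] ab /eqP]|xy].
- by rewrite xpair_eqE !eq_shift.
- by rewrite xpair_eqE !eq_shift => /andP[/eqP-> /eqP->].
by right; apply/imsetP; exists (x, y).
Qed.

Lemma union_lr x y : ((lshift m x, rshift n y) \in union_edges T T') = false.
Proof.
by rewrite inE; apply/norP; split; apply/imsetP => -[[a b] _ /eqP];
  rewrite xpair_eqE !eq_shift ?andbF.
Qed.

Lemma union_rl x y : ((rshift n x, lshift m y) \in union_edges T T') = false.
Proof.
by rewrite inE; apply/norP; split; apply/imsetP => -[[a b] _ /eqP];
  rewrite xpair_eqE !eq_shift ?andbF.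
Qed.

Lemma permutree_backslash : permutree (graft_backslash T T').
Proof.
apply: permutree_of_ptree.
have P1 := ptree_of_permutree hT; have P2 := ptree_of_permutree hT'.
have up_l x : cat_decoration T T' (lshift m x) = decoration T x.
  by rewrite ffunE (unsplitK (inl x)).
have up_r x : cat_decoration T T' (rshift n x) = decoration T' x.
  by rewrite ffunE (unsplitK (inr x)).
apply: (graft_ptree P1 P2) => x; rewrite /ups /downs ?up_l ?up_r //= => y;
  rewrite /edge_rel /graft_backslash [edges _]/= in_setU.
- rewrite union_ll orbC; case: imsetP => //= -[[a b] _ /eqP].
  by rewrite xpair_eqE !eq_shift ?andbF.
- rewrite union_rr orbC; case: imsetP => //= -[[a b] _ /eqP].
  by rewrite xpair_eqE !eq_shift ?andbF.
- rewrite union_lr /= -(rightmostP (fun z => out_danglingE z hT)).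
  rewrite -(leftmostP (fun z => in_danglingE z hT')).
  split=> [/imsetP[[a b]]|[h1 h2]].
    rewrite inE => /andP[h1 h2] /eqP.
    by rewrite xpair_eqE !eq_shift => /andP[/eqP-> /eqP->].
  by apply/imsetP; exists (x, y); rewrite ?inE ?h1.
rewrite union_rl orbC; case: imsetP => //= -[[a b] _ /eqP].
by rewrite xpair_eqE !eq_shift ?andbF.
Qed.

Lemma slash_edge u v : opposite (edge_rel (graft_slash T T')) u v =
  ((v, u) \in union_edges T T') || ((v, u) \in
    [set (rshift n e.2, lshift m e.1) | e : 'I_n * 'I_m &
       rightmost (in_dangling T) e.1 && leftmost (out_dangling T') e.2]).
Proof. exact: in_setU. Qed.

Lemma permutree_slash : permutree (graft_slash T T').
Proof.
apply: permutree_of_ptree.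
have P1 := ptree_of_permutree hT; have P2 := ptree_of_permutree hT'.
have up_l x : cat_decoration T T' (lshift m x) = decoration T x.
  by rewrite ffunE (unsplitK (inl x)).
have up_r x : cat_decoration T T' (rshift n x) = decoration T' x.
  by rewrite ffunE (unsplitK (inr x)).
apply: (@ptree_flip _ _ _ _ (opposite (edge_rel (graft_slash T T')))).
apply: (graft_ptree (ptree_flip P1) (ptree_flip P2)) => x;
  rewrite /ups /downs ?up_l ?up_r //= => y;
  rewrite ?[opposite _ (lshift _ _) _]slash_edge
    ?[opposite _ (rshift _ _) _]slash_edge.
- rewrite union_ll orbC; case: imsetP => //= -[[a b] _ /eqP].
  by rewrite xpair_eqE !eq_shift ?andbF.
- rewrite union_rr orbC; case: imsetP => //= -[[a b] _ /eqP].
  by rewrite xpair_eqE !eq_shift ?andbF.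
- rewrite union_rl /= -(rightmostP (fun z => in_danglingE z hT)).
  rewrite -(leftmostP (fun z => out_danglingE z hT')).
  split=> [/imsetP[[a b]]|[h1 h2]].
    rewrite inE => /andP[h1 h2] /eqP.
    by rewrite xpair_eqE !eq_shift => /andP[/eqP-> /eqP->].
  by apply/imsetP; exists (x, y); rewrite ?inE ?h1.
rewrite union_lr orbC; case: imsetP => //= -[[a b] _ /eqP].
by rewrite xpair_eqE !eq_shift ?andbF.
Qed.

End GraftBridge.

(** * Walking between linear extensions *)

Section Extensions.
Variable N : nat.
Implicit Types (S : decorated_digraph N) (s : 'S_N) (p q x y : 'I_N).

Definition position s : 'I_N -> nat := fun x => (s^-1)%g x.

Lemma linear_extensionP S s :
  reflect (extends (edge_rel S) (position s)) (linear_extension S s).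
Proof.
apply: (iffP idP) => [/'forall_'forall_implyP h x y|h]; first exact: h.
by apply/'forall_'forall_implyP => x y; apply: h.
Qed.

Lemma position_inj s : injective (position s).
Proof. by move=> x y /ord_inj /perm_inj. Qed.

Lemma permutree_unique S S' s : permutree S -> permutree S' ->
  decoration S = decoration S' -> linear_extension S s -> linear_extension S' s ->
  S = S'.
Proof.
move=> pS pS' d /linear_extensionP e /linear_extensionP e'.
have P := ptree_of_permutree pS; have := ptree_of_permutree pS'.
rewrite /ptree_of /ups /downs -d => P'.
have E := common_extension_eq P P' e e'.
case: S S' d E {pS pS' e e' P P'} => [d E] [d' E'] /= -> EE; congr pair.
by apply/setP => -[x y]; apply: EE.
Qed.

Definition swap_at (p q : 'I_N) s : 'S_N := (tperm p q * s)%g.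

Lemma swap_atK p q s : swap_at p q (swap_at p q s) = s.
Proof. by rewrite /swap_at mulgA tperm2 mul1g. Qed.

Lemma position_swap p q s x : position (swap_at p q s) x = tperm p q ((s^-1)%g x).
Proof. by rewrite /position /swap_at invMg tpermV permM. Qed.

(** Exchanging two consecutive letters changes the order of no other pair. *)
Lemma swap_lt p q s x y : q = p.+1 :> nat -> (x, y) != (s p, s q) ->
  position s x < position s y ->
  position (swap_at p q s) x < position (swap_at p q s) y.
Proof.
move=> pq; rewrite !position_swap /position xpair_eqE.
rewrite -[x == _](inj_eq (@perm_inj _ (s^-1)%g)).
rewrite -[y == _](inj_eq (@perm_inj _ (s^-1)%g)) !permK.
set a := (s^-1)%g x; set b := (s^-1)%g y.
by case: tpermP => [->|->|/eqP + /eqP +]; case: tpermP => [->|->|/eqP + /eqP +];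
  rewrite -!val_eqE /= ?pq; clear; lia.
Qed.

(** The vertices moved by the rotation along [s p -> s q] come before both
    letters or after both, so only the reversed edge is affected. *)
Lemma extension_swap S s p q : permutree S -> linear_extension S s ->
  q = p.+1 :> nat -> s p < s q ->
  exists S', [/\ permutree S', permutree_le S S' & linear_extension S' (swap_at p q s)].
Proof.
move=> pS /linear_extensionP e pq lt.
have posp : position s (s p) = p by rewrite /position permK.
have posq : position s (s q) = q by rewrite /position permK.
have spp : position (swap_at p q s) (s p) = q by rewrite position_swap permK tpermL.
have spq : position (swap_at p q s) (s q) = p by rewrite position_swap permK tpermR.
have npq : p != q by rewrite -val_eqE /= pq; clear; lia.
have far x : position s x < p \/ q < position s x ->
    position (swap_at p q s) x = position s x.
  rewrite position_swap /position => h; rewrite tpermD //; apply/eqP => e';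
    by rewrite -e' pq in h; move: h; clear; lia.
have [ed|ned] := boolP ((s p, s q) \in edges S); last first.
  exists S; split=> //; first exact: connect0.
  apply/linear_extensionP => x y xy; apply: swap_lt (e _ _ xy) => //.
  by apply: contraNneq ned => <-.
have pR := permutree_rotate pS ed lt.
exists (rotate S (s p) (s q)); split=> //.
  apply: connect1; apply/and3P; split=> //.
  by apply/existsP; exists (s p); apply/existsP; exists (s q); rewrite ed lt /=.
apply/linear_extensionP => x y; rewrite edge_rel_rotate => /rotation_step.
case=> [xy ne|-> ->|xp ->|-> qy].
- by apply: swap_lt (e _ _ xy) => //; apply/eqP.
- by rewrite spp spq pq.
- have := e _ _ xp; rewrite posp => lx; rewrite spq far //; by left.
by have := e _ _ qy; rewrite posq => ly; rewrite spp far //; right.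
Qed.

Lemma adjacent_change (Q : pred 'I_N) p q : p < q -> Q p -> ~~ Q q ->
  exists p' q', [/\ q' = p'.+1 :> nat, Q p' & ~~ Q q'].
Proof.
move=> + Qp; case: q; elim=> [//|k IH] kN; rewrite /= ltnS => pk Qq.
have kN' : k < N by apply: ltnW.
have [Qk|Qk] := boolP (Q (Ordinal kN')); first by exists (Ordinal kN'), (Ordinal kN).
apply: (IH kN') => //=; rewrite ltn_neqAle pk andbT.
by apply: contraNneq Qk => e; rewrite (_ : Ordinal kN' = p) //; apply: val_inj.
Qed.

End Extensions.

Section Walk.
Variables (n m : nat) (T : decorated_digraph n) (T' : decorated_digraph m).
Hypotheses (hT : permutree T) (hT' : permutree T').
Implicit Types (s : 'S_(n + m)) (S : decorated_digraph (n + m)) (p q : 'I_(n + m)).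

Definition restricts_to_extensions s : Prop :=
  extends (edge_rel T) (position s \o lshift m) /\
  extends (edge_rel T') (position s \o @rshift n m).

Let small : pred 'I_(n + m) := fun x => x < n.
Let small_l x : small (lshift m x). Proof. by rewrite /small /=. Qed.
Let small_r x : small (rshift n x) = false.
Proof. by rewrite /small /= ltnNge leq_addr. Qed.
Let small_lt x y : small x -> ~~ small y -> x < y.
Proof. by rewrite /small -leqNgt; apply: leq_trans. Qed.

Lemma interval_restricts S s :
  S \in permutree_interval (graft_backslash T T') (graft_slash T T') ->
  linear_extension S s -> restricts_to_extensions s.
Proof.
rewrite inE => /and3P[_ leL leR] /linear_extensionP e.
have [_ _ dec] := permutree_le_mono leL; have [_ inc _] := permutree_le_mono leR.
have key x y : x != y -> (x, y) \in union_edges T T' -> position s x < position s y.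
  move=> xy uxy; rewrite ltn_neqAle (inj_eq (@position_inj _ s)) xy /=.
  apply: (extends_connect e); move: xy; rewrite -val_eqE neq_ltn => /orP[lt|lt].
    by apply: inc => //; apply: connect1; apply/setUP; left.
  by apply: dec => //; apply: connect1; apply/setUP; left.
split=> x y xy /=; apply: key; rewrite ?union_ll ?union_rr //.
  by rewrite eq_shift (ptree_neq (ptree_of_permutree hT)).
by rewrite eq_shift (ptree_neq (ptree_of_permutree hT')).
Qed.

Lemma restricts_swap s p q : q = p.+1 :> nat -> small (s p) != small (s q) ->
  restricts_to_extensions s -> restricts_to_extensions (swap_at p q s).
Proof.
move=> pq ne [h h']; split=> x y xy /=; apply: swap_lt => //; try exact: h; try exact: h'.
  by apply: contraNneq ne => -[<- <-]; rewrite !small_l.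
by apply: contraNneq ne => -[<- <-]; rewrite !small_r.
Qed.

(** The pairs of a small and a large value in the given order. There are none
    with the large value first in the word of T \ T' to start from, and none
    with the small value first in the final word. *)
Definition crossings (small_first : bool) s : {set 'I_(n + m) * 'I_(n + m)} :=
  [set e | [&& small e.1 == small_first, small e.2 != small_first
             & position s e.1 < position s e.2]].

Lemma crossings_swap b s p q : q = p.+1 :> nat -> small (s p) = b -> small (s q) = ~~ b ->
  #|crossings b (swap_at p q s)| < #|crossings b s|.
Proof.
move=> pq sp sq; apply: proper_card; apply/properP; split.
  apply/subsetP => -[x y]; rewrite !inE /= => /and3P[xb yb lt]; rewrite xb yb /=.
  rewrite -(swap_atK p q s); apply: swap_lt => //.
  apply: contraTneq xb => -[-> _]; rewrite /swap_at permM tpermL sq.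
  by case: b {sp sq yb}.
exists (s p, s q); rewrite !inE /= sp sq eqxx ?position_swap /position !permK.
  by rewrite pq ltnSn; case: b {sp sq}.
by rewrite tpermL tpermR pq ltnNge leqnSn !andbF.
Qed.

Lemma crossings_change b s : crossings b s != set0 ->
  exists p q, [/\ q = p.+1 :> nat, small (s p) = b & small (s q) = ~~ b].
Proof.
case/set0Pn => -[x y]; rewrite inE => /and3P[/= /eqP xb yb lt].
have [p [q [pq /eqP Qp Qq]]] : exists p q : 'I_(n + m),
    [/\ q = p.+1 :> nat, small (s p) == b & ~~ (small (s q) == b)].
  apply: (@adjacent_change _ (fun p => small (s p) == b) _ _ lt); rewrite permKV //.
  by rewrite xb.
by exists p, q; split=> //; move: Qq; case: (small _); case: b {xb yb Qp}.
Qed.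

Lemma extension_backslash s : restricts_to_extensions s -> crossings false s = set0 ->
  linear_extension (graft_backslash T T') s.
Proof.
move=> [h h'] c0; apply/linear_extensionP => x y.
rewrite /edge_rel !in_setU -orbA => /or3P[] /imsetP[[a b] ab [-> ->]].
- exact: h.
- exact: h'.
rewrite ltnNge leq_eqVlt negb_or (inj_eq (@position_inj _ s)) !eq_shift /=.
apply/negP => lt; suff : (rshift n b, lshift m a) \in crossings false s by rewrite c0 inE.
by rewrite inE /= small_l small_r lt.
Qed.

Lemma extension_slash s : restricts_to_extensions s -> crossings true s = set0 ->
  linear_extension (graft_slash T T') s.
Proof.
move=> [h h'] c0; apply/linear_extensionP => x y.
rewrite /edge_rel !in_setU -orbA => /or3P[] /imsetP[[a b] ab [-> ->]].
- exact: h.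
- exact: h'.
rewrite ltnNge leq_eqVlt negb_or (inj_eq (@position_inj _ s)) !eq_shift /=.
apply/negP => lt; suff : (lshift m a, rshift n b) \in crossings true s by rewrite c0 inE.
by rewrite inE /= small_l small_r lt.
Qed.

(** Sorting the small letters of [s] before the large ones goes down the order,
    so the permutree of [s] is found by following the exchanges backwards. *)
Lemma walk_up_from_backslash s : restricts_to_extensions s ->
  exists S, [/\ permutree S, permutree_le (graft_backslash T T') S & linear_extension S s].
Proof.
have [k] := ubnP #|crossings false s|; elim: k s => // k IH s; rewrite ltnS => le res.
have [c0|/crossings_change[p [q [pq sp sq]]]] := eqVneq (crossings false s) set0.
  exists (graft_backslash T T'); split; [exact: permutree_backslash | exact: connect0 |].
  exact: extension_backslash.
have res' : restricts_to_extensions (swap_at p q s).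
  by apply: restricts_swap => //; rewrite sp sq.
have [S [pS leS eS]] := IH _ (leq_trans (crossings_swap pq sp sq) le) res'.
have lt : swap_at p q s p < swap_at p q s q.
  by rewrite /swap_at !permM tpermL tpermR small_lt ?sp ?sq.
have [S' [pS' leS' eS']] := extension_swap pS eS pq lt.
exists S'; split=> //; first exact: connect_trans leS leS'.
by rewrite swap_atK in eS'.
Qed.

Lemma walk_up_to_slash S s : restricts_to_extensions s -> permutree S ->
  decoration S = cat_decoration T T' -> linear_extension S s ->
  permutree_le S (graft_slash T T').
Proof.
have [k] := ubnP #|crossings true s|; elim: k s S => // k IH s S.
rewrite ltnS => le res pS dS eS.
have [c0|/crossings_change[p [q [pq sp sq]]]] := eqVneq (crossings true s) set0.
  have -> : S = graft_slash T T'; last exact: connect0.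
  apply: permutree_unique eS (extension_slash res c0) => //.
  exact: permutree_slash.
have res' : restricts_to_extensions (swap_at p q s).
  by apply: restricts_swap => //; rewrite sp sq.
have lt : s p < s q by rewrite small_lt ?sp ?sq.
have [S' [pS' leS' eS']] := extension_swap pS eS pq lt.
have [dS' _ _] := permutree_le_mono leS'.
apply: connect_trans (leS') (IH _ S' _ res' pS' _ eS'); last by rewrite dS'.
exact: leq_trans (crossings_swap pq sp sq) le.
Qed.

Lemma interval_decoration S :
  S \in permutree_interval (graft_backslash T T') (graft_slash T T') ->
  decoration S = cat_decoration T T'.
Proof. by rewrite inE => /and3P[_ /permutree_le_mono[-> _ _] _]. Qed.

Lemma interval_exists s : restricts_to_extensions s ->
  exists2 S, S \in permutree_interval (graft_backslash T T') (graft_slash T T')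
    & linear_extension S s.
Proof.
move=> res; have [S [pS leS eS]] := walk_up_from_backslash res.
have [dS _ _] := permutree_le_mono leS.
by exists S => //; rewrite inE pS leS (walk_up_to_slash res).
Qed.

End Walk.

(** * Shuffles and the product *)

Section Shuffles.
Variable A : eqType.
Implicit Types (u v w : seq A) (a : pred A).

Lemma filter_all_eq a v w : all a v ->
  (w == v) = (filter (predC a) w == [::]) && (filter a w == v).
Proof.
elim: w v => [|z w IH] [|y v] //=; first by case: (a z); rewrite ?andbF.
case/andP=> ay av; case: (boolP (a z)) => az /=.
  by rewrite !eqseq_cons (IH v av) andbCA.
by apply/eqP => -[zy _]; rewrite zy ay in az.
Qed.

Lemma mem_map_cons x z w (l : seq (seq A)) :
  (z :: w \in [seq x :: t | t <- l]) = (z == x) && (w \in l).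
Proof.
apply/mapP/andP => [[t tl [-> ->]]|[/eqP-> wl]]; first by rewrite eqxx.
by exists w.
Qed.

Lemma nil_map_cons x (l : seq (seq A)) : [::] \in [seq x :: t | t <- l] = false.
Proof. by apply/mapP => -[]. Qed.

(** As the letters of [u] and [v] are told apart by [a], a shuffle can be undone;
    this is also why no word occurs twice. *)
Lemma mem_shuffles a u v w : all a u -> all (predC a) v ->
  (w \in shuffles u v) = (filter a w == u) && (filter (predC a) w == v).
Proof.
elim: u v w => [|x u IHu] v w.
  move=> _ av; have -> : shuffles [::] v = [:: v] by case: v {av}.
  rewrite inE (filter_all_eq w av); congr ((_ == _) && _).
  by apply: eq_filter => z /=; rewrite negbK.
move=> /[dup] axu /andP[ax au]; elim: v w => [|y v IHv] w.
  by move=> _ /=; rewrite inE (filter_all_eq w axu) andbC.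
move=> /[dup] ayv /andP[ay av] /=; rewrite mem_cat.
case: w => [|z w]; first by rewrite !nil_map_cons.
rewrite !mem_map_cons (IHu _ _ au ayv) (IHv _ av) /=.
case: (boolP (a z)) => az /=; rewrite !eqseq_cons.
  rewrite (_ : z == y = false) ?orbF ?andbA //.
  by apply: contraNF ay => /eqP <-.
rewrite (_ : z == x = false) ?orFb; first by rewrite andbCA.
by apply: contraNF az => /eqP ->.
Qed.

Lemma uniq_shuffles a u v : all a u -> all (predC a) v -> uniq (shuffles u v).
Proof.
elim: u v => [|x u IHu] v; first by case: v.
move=> /[dup] axu /andP[ax au]; elim: v => [|y v IHv] //.
move=> /[dup] ayv /andP[ay av] /=; rewrite cat_uniq !map_inj_uniq ?IHu ?IHv //=;
  try by move=> ? ? [].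
rewrite andbT; apply/hasPn => _ /mapP[t _ ->] /=; rewrite mem_map_cons.
by rewrite (_ : y == x = false) //; apply: contraNF ay => /eqP ->.
Qed.

End Shuffles.

Section Words.
Variable N : nat.

Definition letters (s : 'S_N) : seq nat := [seq val (s p) | p <- enum 'I_N].

Lemma size_letters s : size (letters s) = N.
Proof. by rewrite size_map size_enum_ord. Qed.

Lemma letters_inj : injective letters.
Proof.
move=> s t /eq_in_map h; apply/permP => p; apply: val_inj; apply: h.
by rewrite mem_enum.
Qed.

Lemma letters_perm s : perm_eq (letters s) (iota 0 N).
Proof.
rewrite -val_enum_ord /letters (map_comp val s); apply/perm_map/uniq_perm.
- by rewrite map_inj_uniq ?enum_uniq //; apply: perm_inj.
- exact: enum_uniq.
move=> i; rewrite mem_enum; apply/mapP; exists ((s^-1)%g i); first by rewrite mem_enum.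
by rewrite permKV.
Qed.

Lemma lettersP (l : seq nat) : perm_eq l (iota 0 N) -> exists s, letters s = l.
Proof.
move=> pl; have sl : size l = N by rewrite (perm_size pl) size_iota.
have ltl (p : 'I_N) : nth 0 l p < N.
  have : nth 0 l p \in l by rewrite mem_nth ?sl.
  by rewrite (perm_mem pl) mem_iota.
pose f p := Ordinal (ltl p).
have f_inj : injective f.
  move=> p q [/eqP]; rewrite nth_uniq ?sl //; first by move/eqP/val_inj.
  by rewrite (perm_uniq pl) iota_uniq.
exists (perm f_inj); apply: (@eq_from_nth _ 0); rewrite size_letters ?sl // => k kN.
rewrite (nth_map (Ordinal kN)) ?size_enum_ord // permE /=.
by rewrite nth_enum_ord.
Qed.

Lemma index_letters s (x : 'I_N) : index (val x) (letters s) = position s x.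
Proof.
rewrite /letters -{1}(permKV s x) (map_comp val s) index_map; last exact: val_inj.
by rewrite index_map ?index_enum_ord //; apply: perm_inj.
Qed.

End Words.

Lemma index_filter_lt (A : eqType) (a : pred A) (l : seq A) x y : a x -> a y ->
  (index x (filter a l) < index y (filter a l)) = (index x l < index y l).
Proof.
move=> ax ay; elim: l => //= h l IH; case: ifP => ah /=.
  by case: eqP => _; case: eqP => _; rewrite ?ltnS.
have /negPf-> : h != x by apply: contraFneq ah => ->.
by have /negPf-> : h != y by apply: contraFneq ah => ->.
Qed.

Section Bilinear.
Variable K : fieldType.
Notation dp_space := {malg K[decorated_perm]}.
Implicit Types x y : dp_space.

(** Summing over larger supports makes both arguments of the product additive. *)
Lemma dp_mul_widen x y (A B : {fset decorated_perm}) :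
  (msupp x `<=` A)%fset -> (msupp y `<=` B)%fset ->
  dp_mul x y = (\sum_(s <- A) \sum_(t <- B) (x@_s * y@_t) *: dp_mul_basis K s t)%R.
Proof.
move=> xA yB; rewrite /dp_mul; under eq_bigr => s _.
  rewrite (big_fset_incl _ yB); last first.
    by move=> t _ /mcoeff_outdom->; rewrite mulr0 scale0r.
  over.
apply: big_fset_incl => // s _ /mcoeff_outdom->.
by rewrite big1 // => t _; rewrite mul0r scale0r.
Qed.

Lemma dp_mulDl y : {morph (fun x => dp_mul x y) : x x' / (x + x')%R}.
Proof.
move=> x x'; have B := fsubset_refl (msupp y).
rewrite (dp_mul_widen (msuppD_le x x') B) (dp_mul_widen (fsubsetUl _ (msupp x')) B).
rewrite (dp_mul_widen (fsubsetUr (msupp x) _) B) -big_split; apply: eq_bigr => s _.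
by rewrite -big_split; apply: eq_bigr => t _; rewrite mcoeffD mulrDl scalerDl.
Qed.

Lemma dp_mulDr x : {morph dp_mul x : y y' / (y + y')%R}.
Proof.
move=> y y'; have A := fsubset_refl (msupp x).
rewrite (dp_mul_widen A (msuppD_le y y')) (dp_mul_widen A (fsubsetUl _ (msupp y'))).
rewrite (dp_mul_widen A (fsubsetUr (msupp y) _)) -big_split; apply: eq_bigr => s _.
by rewrite -big_split; apply: eq_bigr => t _; rewrite mcoeffD mulrDr scalerDl.
Qed.

Lemma dp_mul0l y : dp_mul 0%R y = 0%R.
Proof. by rewrite /dp_mul msupp0 big_seq_fset0. Qed.

Lemma dp_mul0r x : dp_mul x 0%R = 0%R.
Proof. by rewrite /dp_mul big1 // => s _; rewrite msupp0 big_seq_fset0. Qed.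

Lemma dp_mul_sum (I J : finType) (P : pred I) (Q : pred J) f g :
  dp_mul (\sum_(i | P i) << f i >>)%R (\sum_(j | Q j) << g j >>)%R =
  (\sum_(i | P i) \sum_(j | Q j) dp_mul_basis K (f i) (g j))%R.
Proof.
rewrite (big_morph (fun x => dp_mul x _) (dp_mulDl _) (dp_mul0l _)).
apply: eq_bigr => i _; rewrite (big_morph _ (dp_mulDr _) (dp_mul0r _)).
by apply: eq_bigr => j _; rewrite dp_mulUU.
Qed.

End Bilinear.

Section Product.
Variables (n m : nat) (T : decorated_digraph n) (T' : decorated_digraph m).

Definition restricts_to (s : 'S_(n + m)) (t : 'S_n) (t' : 'S_m) : bool :=
  ([seq k <- letters s | k < n] == letters t) &&
  ([seq k <- letters s | ~~ (k < n)] == [seq n + k | k <- letters t']).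

Lemma restricts_to_exists s :
  exists t t', forall u u', restricts_to s u u' = (u == t) && (u' == t').
Proof.
have pl : perm_eq (letters s) (iota 0 n ++ iota n m) by rewrite -iotaD letters_perm.
have [t et] : exists t : 'S_n, letters t = [seq k <- letters s | k < n].
  apply: lettersP; apply: perm_trans (perm_filter _ pl) _; rewrite filter_cat.
  rewrite (_ : [seq k <- iota n m | k < n] = [::]) ?cats0.
    by rewrite (all_filterP _) //; apply/allP => k; rewrite mem_iota.
  by apply/eqP; rewrite -(negbK (_ == _)) -has_filter; apply/hasPn => k;
    rewrite mem_iota -leqNgt => /andP[].
have pr : perm_eq [seq k <- letters s | ~~ (k < n)] (iota n m).
  apply: perm_trans (perm_filter _ pl) _; rewrite filter_cat.
  rewrite (_ : [seq k <- iota 0 n | ~~ (k < n)] = [::]) ?cat0s.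
    by rewrite (all_filterP _) //; apply/allP => k; rewrite mem_iota -leqNgt => /andP[].
  by apply/eqP; rewrite -(negbK (_ == _)) -has_filter; apply/hasPn => k;
    rewrite mem_iota negbK.
have [t' et'] : exists t' : 'S_m, letters t' = [seq k - n | k <- letters s & ~~ (k < n)].
  apply: lettersP; apply: perm_trans (perm_map _ pr) _.
  rewrite -[X in iota X]addn0 iotaDl -map_comp (eq_map (g := id)) ?map_id //.
  by move=> k /=; rewrite addKn.
have et2 : [seq k <- letters s | ~~ (k < n)] = [seq n + k | k <- letters t'].
  rewrite et' -map_comp -[LHS]map_id; apply/eq_in_map => k.
  by rewrite mem_filter -leqNgt => /andP[nk _] /=; rewrite subnKC.
exists t, t' => u u'; rewrite /restricts_to -et et2 (inj_eq (@letters_inj _)) eq_sym.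
rewrite (inj_eq (inj_map (@addnI n))) (inj_eq (@letters_inj _)).
by rewrite [t' == u']eq_sym.
Qed.

Lemma restricts_to_extensionsP s t t' : restricts_to s t t' ->
  linear_extension T t && linear_extension T' t' <-> restricts_to_extensions T T' s.
Proof.
case/andP=> /eqP et /eqP et'.
have pt (x y : 'I_n) : (position t x < position t y) =
    (position s (lshift m x) < position s (lshift m y)).
  by rewrite -!index_letters -et index_filter_lt ?ltn_ord.
have pt' (x y : 'I_m) : (position t' x < position t' y) =
    (position s (rshift n x) < position s (rshift n y)).
  rewrite -!index_letters -(index_map (@addnI n)) -[X in _ < X](index_map (@addnI n)).
  by rewrite -et' index_filter_lt //= -leqNgt leq_addr.
split=> [/andP[/linear_extensionP e /linear_extensionP e']|[e e']].
  by split=> x y /=; [move/e; rewrite pt | move/e'; rewrite pt'].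
by apply/andP; split; apply/linear_extensionP => x y;
  [move/e; rewrite pt | move/e'; rewrite pt'].
Qed.

(** [DecN] is a default for the numbers that label no vertex. *)
Definition letter k (d : {ffun 'I_k -> decor}) (i : nat) : nat * decor :=
  (i, if insub i is Some x then d x else DecN).

Lemma word_letters k (S : decorated_digraph k) s :
  perm_decorated_word S s = map (letter (decoration S)) (letters s).
Proof.
rewrite -map_comp; apply: eq_map => p /=; rewrite /letter.
by rewrite (valK (s p)).
Qed.

Lemma letters_word k (S : decorated_digraph k) s :
  [seq x.1 | x <- perm_decorated_word S s] = letters s.
Proof. by rewrite -map_comp. Qed.

Lemma perm_decorated_inj k (S : decorated_digraph k) : injective (perm_decorated S).
Proof.
move=> s t /(congr1 dp_word) /= e; apply: letters_inj.
by rewrite -!(letters_word S) e.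
Qed.

Lemma perm_decorated_eq k (S S' : decorated_digraph k) : decoration S = decoration S' ->
  perm_decorated S =1 perm_decorated S'.
Proof. by move=> e s; apply: val_inj; rewrite /= !word_letters e. Qed.

Lemma letter_catl i : i < n -> letter (cat_decoration T T') i = letter (decoration T) i.
Proof.
move=> lin; congr pair; rewrite (insubT (fun j => j < n) lin).
rewrite (insubT (fun j => j < n + m) (ltn_addr m lin)) ffunE.
by rewrite (_ : Sub _ _ = lshift m (Ordinal lin)) ?(unsplitK (inl _)) //; apply: val_inj.
Qed.

Lemma letter_catr i : i < m ->
  letter (cat_decoration T T') (n + i) = (n + i, (letter (decoration T') i).2).
Proof.
move=> lim; congr pair; have lnm : n + i < n + m by rewrite ltn_add2l.
rewrite (insubT (fun j => j < n + m) lnm) /letter /= (insubT (fun j => j < m) lim) ffunE.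
by rewrite (_ : Sub _ _ = rshift n (Ordinal lim)) ?(unsplitK (inr _)) //; apply: val_inj.
Qed.

Lemma letters_lt k (s : 'S_k) i : i \in letters s -> i < k.
Proof. by rewrite (perm_mem (letters_perm s)) mem_iota. Qed.

(** The graft only serves to decorate the letters: a shuffle is a word on the
    decorated values of T and T', which is a permutation of their union. *)
Lemma shuffle_basis (K : fieldType) t t' :
  dp_mul_basis K (perm_decorated T t) (perm_decorated T' t') =
  (\sum_(s | restricts_to s t t')
     << perm_decorated (graft_backslash T T') s >>)%R.
Proof.
pose W := perm_decorated (graft_backslash T T'); pose a (l : nat * decor) := l.1 < n.
set u := perm_decorated_word T t.
pose v := shift_word n (perm_decorated_word T' t').
have su : size u = n by rewrite size_map size_enum_ord.
have shE : shifted_shuffles (perm_decorated T t) (perm_decorated T' t') = shuffles u v.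
  by rewrite /shifted_shuffles /= -/u su.
have au : all a u.
  by apply/allP => l; rewrite /u word_letters => /mapP[i /letters_lt lin ->].
have av : all (predC a) v.
  by apply/allP => _ /mapP[l _ ->]; rewrite /a /= -leqNgt leq_addr.
have uE : u = map (letter (cat_decoration T T')) (letters t).
  rewrite /u word_letters; apply/eq_in_map => i /letters_lt lin.
  by rewrite letter_catl.
have vE : v = map (letter (cat_decoration T T')) [seq n + i | i <- letters t'].
  rewrite /v word_letters /shift_word -!(map_comp _ _ (letters t')).
  apply/eq_in_map => i /letters_lt lim.
  by rewrite /= letter_catr.
have WE s : dp_word (W s) = map (letter (cat_decoration T T')) (letters s).
  exact: word_letters.
rewrite /dp_mul_basis shE.
rewrite (perm_big [seq W s | s <- enum (fun s => restricts_to s t t')]) /=.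
  by rewrite big_map big_enum.
apply: uniq_perm.
- by apply: pmap_sub_uniq; apply: uniq_shuffles av.
- by rewrite map_inj_uniq ?enum_uniq //; apply: perm_decorated_inj.
move=> w; rewrite mem_pmap_sub (mem_shuffles _ au av) /=.
apply/andP/mapP => [[/eqP fu /eqP fv]|[s]].
  have wE : dp_word w = [seq letter (cat_decoration T T') l.1 | l <- dp_word w].
    rewrite -[LHS]map_id; apply/eq_in_map => l lw.
    case: (boolP (a l)) => al.
      have : l \in u by rewrite -fu mem_filter al.
      by rewrite uE => /mapP[i _ ->].
    have : l \in v by rewrite -fv mem_filter /= al.
    by rewrite vE => /mapP[i _ ->].
  have [s es] : exists s : 'S_(n + m), letters s = [seq l.1 | l <- dp_word w].
    apply: lettersP; have := dp_wordP w; rewrite /is_decorated_perm.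
    suff -> : size (dp_word w) = n + m by [].
    have /shuffles_perm_eq/perm_size-> : dp_word w \in shuffles u v.
      by rewrite (mem_shuffles _ au av) fu fv !eqxx.
    by rewrite size_cat su size_map size_map size_enum_ord.
  exists s.
    rewrite mem_enum; apply/andP; rewrite es !filter_map.
    rewrite (_ : [seq l <- _ | _] = u) ?[X in _ /\ [seq _.1 | _ <- X] == _](_ : _ = v) //.
    by rewrite letters_word eqxx vE -map_comp map_id_in.
  apply: val_inj; apply: etrans wE _.
  by rewrite -[RHS]/(dp_word (W s)) WE es -map_comp.
rewrite mem_enum => /andP[/eqP e1 /eqP e2] ->.
rewrite -[val _]/(dp_word (W s)) WE (filter_map _ a) (filter_map _ (predC a)).
rewrite (eq_filter (a2 := fun k => k < n)) // e1 -uE.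
by rewrite (eq_filter (a2 := fun k => ~~ (k < n))) // e2 -vE.
Qed.

End Product.

Local Open Scope ring_scope.

Theorem proposition61 (K : fieldType) (n m : nat)
    (T : decorated_digraph n) (T' : decorated_digraph m)
    (hT : permutree T) (hT' : permutree T') :
  dp_mul (PT K T) (PT K T') =
  \sum_(S in permutree_interval (graft_backslash T T') (graft_slash T T'))
    PT K S.
Proof.
rewrite /PT dp_mul_sum.
under eq_bigr => t _ do under eq_bigr => t' _ do rewrite shuffle_basis.
rewrite pair_big /=; rewrite (exchange_big_dep predT) //=.
under [RHS]eq_bigr => S SI.
  under eq_bigr => s _ do
    rewrite (perm_decorated_eq (S' := graft_backslash T T')
      (interval_decoration SI)).
  over.
rewrite [RHS](exchange_big_dep predT) //=; apply: eq_bigr => s _.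
have [t [t' tE]] := restricts_to_exists s.
have rt : restricts_to s t t' by rewrite tE !eqxx.
have resP := restricts_to_extensionsP T T' rt.
rewrite (eq_bigl (fun p => (linear_extension T t && linear_extension T' t')
  && (p == (t, t')))); last first.
  move=> [u u'] /=; rewrite tE xpair_eqE.
  by case: eqP => [->|]; case: eqP => [->|]; rewrite ?andbF ?andbT.
have [/resP res|nres] := boolP (linear_extension T t && linear_extension T' t');
  last first.
  rewrite !big_pred0 //; move=> S; apply: contraNF nres => /andP[SI e].
  exact/resP/(interval_restricts hT hT' SI e).
have [S0 S0I e0] := interval_exists hT hT' res.
rewrite big_pred1_eq (big_pred1 S0) // => S.
apply/andP/eqP => [[SI e]|->] //.
apply: permutree_unique e e0; last first.
- by rewrite (interval_decoration SI) (interval_decoration S0I).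
- by move: S0I; rewrite inE => /andP[].
by move: SI; rewrite inE => /andP[].
Qed.
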